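(* Let $G$ be a 3-edge-connected near-bipartite cubic graph which is not isomorphic to $K_4$. Then $G$ has a matching $M$ with $|M|\geq |V(G)|/2-3$ such that every edge of $M$ is removable in $G$.
   Context: All graphs are finite, simple and undirected. A connected graph is matching covered if every edge lies in some perfect matching. An edge $e$ of a matching covered graph $G$ is removable if $G-e$ is matching covered. A non-bipartite matching covered graph $G$ is near-bipartite if it has two edges $e,f$ such that $G-\{e,f\}$ is bipartite and matching covered. *)

(* Defs.v *)
From mathcomp Require Import all_boot.

Set Implicit Arguments.
Unset Strict Implicit.
Unset Printing Implicit Defensive.

Record sgraph := SGraph {
  vertex :> finType;
  adj : rel vertex;
  adj_sym : symmetric adj;
  adj_irrefl : irreflexive adj
}.

Section Graphs.
Variable G : sgraph.
Implicit Types (e f : {set G}) (F M : {set {set G}}).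

(* An edge is the two-element set of its ends. *)
Definition edges : {set {set G}} :=
  [set e : {set G} |
    [exists x : G, exists y : G, adj x y && (e == [set x; y])]].

Definition del_adj F : rel G :=
  fun x y => adj x y && ([set x; y] \notin F).

Lemma del_adj_sym F : symmetric (del_adj F).
Proof. by move=> x y; rewrite /del_adj adj_sym setUC. Qed.

Lemma del_adj_irrefl F : irreflexive (del_adj F).
Proof. by move=> x; rewrite /del_adj adj_irrefl. Qed.

(* G - F: same vertices, the edges in F deleted. *)
Definition del_edges F : sgraph :=
  SGraph (del_adj_sym F) (del_adj_irrefl F).

Definition connected : bool :=
  [forall x : G, forall y : G, connect (@adj G) x y].

Definition cubic : bool :=
  [forall x : G, #|[set y : G | adj x y]| == 3].

Definition bipartite : bool :=
  [exists A : {set G}, forall x : G, forall y : G,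
     adj x y ==> ((x \in A) != (y \in A))].

Definition matching M : bool := (M \subset edges) && trivIset M.

Definition perfect_matching M : bool :=
  matching M && (cover M == [set: G]).

End Graphs.

Definition k_edge_connected (k : nat) (G : sgraph) : bool :=
  (1 < #|G|) &&
  [forall F : {set {set G}},
     (F \subset edges G) && (#|F| < k) ==> connected (del_edges F)].

Definition matching_covered (G : sgraph) : bool :=
  connected G &&
  [forall e in edges G,
     exists M : {set {set G}}, perfect_matching M && (e \in M)].

(* Only meant for matching covered G. *)
Definition removable (G : sgraph) (e : {set G}) : bool :=
  (e \in edges G) && matching_covered (del_edges [set e]).

Definition near_bipartite (G : sgraph) : Prop :=
  [/\ matching_covered G, ~~ bipartite G &
      exists e f : {set G},
        [/\ e \in edges G, f \in edges G, e != f,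
            bipartite (del_edges [set e; f]) &
            matching_covered (del_edges [set e; f])]].

Definition isomorphic (G H : sgraph) : Prop :=
  exists2 h : G -> H, bijective h & forall x y, adj (h x) (h y) = adj x y.

Definition complete_adj (n : nat) : rel 'I_n := fun i j => i != j.

Lemma complete_adj_sym n : symmetric (@complete_adj n).
Proof. by move=> i j; rewrite /complete_adj eq_sym. Qed.

Lemma complete_adj_irrefl n : irreflexive (@complete_adj n).
Proof. by move=> i; rewrite /complete_adj eqxx. Qed.

Definition complete_graph (n : nat) : sgraph :=
  SGraph (@complete_adj_sym n) (@complete_adj_irrefl n).

(* Main.v *)
(* Let e = a1 a2 and f = b1 b2 be the two edges with G - {e, f} bipartite; by
   cubicity they lie inside different colour classes A and B, and |A| = |B|.
   By Hall's theorem, an edge uv of G - {e, f} fails to be removable only if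
   there is a set of vertices with a cut of at most four edges and a prescribed
   position relative to e and f that certifies this.  Two kinds of certificate
   occur: a 3-edge cut separating f from e that contains uv, or a 4-edge cut
   whose only edge from A outside to B inside is uv.

   The 3-edge cuts separating f from e form a chain.  If there are any, Hall's
   theorem applied to the layers of the chain yields, for each i and j, a matching
   that covers all vertices but ai and bj and avoids all these cuts.  Counting its
   edges across a 4-edge certificate shows that it contains a certified edge
   only above the largest or below the smallest 3-edge cut.  For a suitable
   choice of i and j there is at most one such edge at either end, whence a
   matching of |A| - 3 removable edges.  If there is no such 3-edge cut, the
   certificates containing a1 and b1 form a chain and there is a perfect matching
   of G - {e, f} avoiding their cuts; at most one certificate separates
   a1, b2 from a2, b1 if the chain is non-empty, which costs two edges. *)
Require Import Defs.
From mathcomp Require Import all_boot all_order all_algebra zify.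

Set Implicit Arguments.
Unset Strict Implicit.
Unset Printing Implicit Defensive.

(** Since the two classes have equal size, a perfect matching contains both of e and f or neither.
    To see that uv is removable, Hall's theorem is therefore applied twice for an edge ab of G - {e,
    f}: without e and f, and with both. The complement of the first deficient set is the 4-edge
    certificate; uncrossing with the second one yields edges that lie in 3-edge cuts. These edges
    are part of the certificate because the matching constructed later avoids 3-edge cuts and so
    cannot use them to cross it. All estimates rest on one balance: with the edges of G - {e, f}
    directed from A to B, the class sizes inside a set and its position relative to e and f
    determine the difference between the numbers of edges leaving and entering it. The choice of i
    matters because of a single configuration, a certificate that contains the whole largest set of
    the chain; it cannot occur for both values of i, and likewise for j at the lower end. The
    constant 3 counts the uncovered vertex ai and one bad edge at either end. *)

(** * Hall's theorem *)

Section Hall.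
Variables (T : finType) (r : rel T).
Implicit Types (A B S : {set T}).

Definition neighbours B S := [set y in B | [exists x in S, r x y]].

Definition saturating A B (phi : T -> T) :=
  {in A &, injective phi} /\ forall x, x \in A -> phi x \in B /\ r x (phi x).

(** Induction on [#|A|]. If some non-empty proper subset of [A] has no more neighbours than
    elements, it and the rest are matched separately; otherwise each such subset has a neighbour to
    spare, and one edge can be fixed arbitrarily. *)
Lemma hall A B :
  (forall S, S \subset A -> #|S| <= #|neighbours B S|) ->
  exists phi, saturating A B phi.
Proof.
have [n] := ubnP #|A|; elim: n A B => // n IHn A B leAn hallA.
have [->|[x0 Ax0]] := set_0Vmem A.
  by exists id; split => [x|x]; rewrite inE.
have [/existsP[S /and3P[S0 ltSA tightS]]|] := boolP [exists S : {set T},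
    [&& S != set0, S \proper A & #|neighbours B S| <= #|S|]].
  have sSA := proper_sub ltSA.
  have [] := IHn S (neighbours B S).
  - by have := proper_card ltSA; lia.
  - move=> S' sS'; apply: leq_trans (hallA S' (subset_trans sS' sSA)) _.
    apply/subset_leq_card/subsetP => y; rewrite !inE => /andP[-> xy] /=.
    rewrite xy andbT; case/existsP: xy => x /andP[S'x rxy].
    by apply/existsP; exists x; rewrite (subsetP sS').
  move=> phi1 [inj1 phi1P].
  have [] := IHn (A :\: S) (B :\: neighbours B S).
  - have := cardsID S A; rewrite (setIidPr sSA); move: S0; rewrite -card_gt0.
    lia.
  - move=> S' sS'; have disS : [disjoint S' & S].
      by move: sS'; rewrite subsetD => /andP[].
    have := hallA (S' :|: S); rewrite subUset sSA andbT.
    rewrite (subset_trans sS' (subsetDl _ _)) => /(_ isT).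
    have/eqP -> : #|S' :|: S| == #|S'| + #|S| by rewrite -leq_card_setU in disS *.
    move=> hU.
    suff : #|neighbours B (S' :|: S)|
        <= #|neighbours (B :\: neighbours B S) S'| + #|neighbours B S| by lia.
    apply: leq_trans (leq_card_setU _ _); apply/subset_leq_card/subsetP => y.
    rewrite !inE => /andP[-> /existsP[x /andP[]]] /=.
    rewrite inE andbT => /orP[] Sx rxy; last first.
      by apply/orP; right; apply/existsP; exists x; rewrite Sx.
    case: [exists _ in S, _]; rewrite ?orbT // ?orbF.
    by apply/existsP; exists x; rewrite Sx.
  move=> phi2 [inj2 phi2P].
  exists (fun x => if x \in S then phi1 x else phi2 x); split => [x y Ax Ay|x Ax].
    have phi2N z : z \in A -> z \notin S -> phi2 z \notin neighbours B S.
      move=> Az Sz; have [] := phi2P z; first by rewrite inE Sz Az.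
      by rewrite inE => /andP[].
    case: ifPn => Sx; case: ifPn => Sy.
    - exact: inj1.
    - by move=> eq12; have := phi2N _ Ay Sy; rewrite -eq12 (phi1P _ Sx).1.
    - by move=> eq12; have := phi2N _ Ax Sx; rewrite eq12 (phi1P _ Sy).1.
    - by apply: inj2; rewrite inE ?Sx ?Sy.
  case: ifPn => Sx.
    by have [] := phi1P _ Sx; rewrite inE => /andP[].
  by have [] := phi2P x; rewrite inE ?Sx // => /andP[].
rewrite negb_exists => /forallP slack.
have /card_gt0P[y0] : 0 < #|neighbours B [set x0]|.
  by rewrite (leq_trans _ (hallA _ _)) ?cards1 // sub1set.
rewrite inE => /andP[By0 /existsP[x /andP[/set1P-> r0]]].
have [] := IHn (A :\ x0) (B :\ y0).
- by move: leAn; rewrite (cardsD1 x0) Ax0.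
- move=> S sS; have [->|S0] := eqVneq S set0; first by rewrite cards0.
  have ltSA : S \proper A by exact: sub_proper_trans sS (properD1 Ax0).
  have := slack S; rewrite S0 ltSA /= -ltnNge => ltS.
  suff : #|neighbours B S| <= #|neighbours (B :\ y0) S| + #|[set y0]|.
    by rewrite cards1; lia.
  apply: leq_trans (leq_card_setU _ _); apply/subset_leq_card/subsetP => y.
  rewrite !inE => /andP[-> ->]; rewrite !andbT.
  by case: eqVneq.
move=> phi [injphi phiP].
exists (fun x => if x == x0 then y0 else phi x); split => [u v Au Av|u Au].
  have phiN z : z \in A -> z != x0 -> phi z != y0.
    move=> Az zx0; have [] := phiP z; first by rewrite !inE zx0.
    by rewrite !inE => /andP[].
  case: eqVneq => [->|ux]; case: eqVneq => [->|vx] //.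
  - by move=> eq0; have := phiN _ Av vx; rewrite -eq0 eqxx.
  - by move=> eq0; have := phiN _ Au ux; rewrite eq0 eqxx.
  - by apply: injphi; rewrite !inE ?ux ?vx.
case: eqVneq => [->|ux] //.
by have [] := phiP u; rewrite !inE ?ux // => /andP[].
Qed.

End Hall.

(** * Edge counts, parity and uncrossing of cuts *)

Section Cuts.
Variable G : sgraph.
Implicit Types (X Y Z : {set G}).

(** Ordered pairs are counted, so [ec X X] is twice the number of edges inside [X] and degree sums
    need no correction term. *)
Definition ec X Y :=
  #|[set p : G * G | [&& p.1 \in X, p.2 \in Y & adj p.1 p.2]]|.

Definition cut X := ec X (~: X).

Let swap (p : G * G) := (p.2, p.1).

Let swapK : involutive swap. Proof. by case. Qed.

Lemma ecC X Y : ec X Y = ec Y X.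
Proof.
rewrite /ec -(card_imset _ (inv_inj swapK)).
apply: eq_card => -[x y]; rewrite !inE /=.
apply/imsetP/idP => [[[u v]]|/and3P[Yx Xy xy]].
  by rewrite inE /= => /and3P[Xu Yv uv] [-> ->]; rewrite Xu Yv adj_sym.
by exists (y, x); rewrite // inE /= Yx Xy adj_sym.
Qed.

Lemma ec_splitl Z X Y : ec X Y = ec (X :&: Z) Y + ec (X :\: Z) Y.
Proof.
rewrite /ec -(cardsID [set p | p.1 \in Z]); congr (_ + _); apply: eq_card => p.
  by rewrite !inE; case: (_ \in X); case: (_ \in Z); rewrite ?andbT ?andbF.
by rewrite !inE; case: (_ \in X); case: (_ \in Z); rewrite ?andbT ?andbF.
Qed.

Lemma ec_splitr Z X Y : ec X Y = ec X (Y :&: Z) + ec X (Y :\: Z).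
Proof. by rewrite ecC (ec_splitl Z) -!(ecC X). Qed.

Lemma ec_sub X X' Y Y' : X \subset X' -> Y \subset Y' -> ec X Y <= ec X' Y'.
Proof.
move=> /subsetP sX /subsetP sY; apply/subset_leq_card/subsetP => p.
by rewrite !inE => /and3P[/sX-> /sY-> ->].
Qed.

Lemma ec_gt0 X Y x y : x \in X -> y \in Y -> adj x y -> 0 < ec X Y.
Proof.
by move=> Xx Yy xy; apply/card_gt0P; exists (x, y); rewrite inE Xx Yy.
Qed.

Lemma ec_gt0P X Y :
  reflect (exists x y, [/\ x \in X, y \in Y & adj x y]) (0 < ec X Y).
Proof.
apply: (iffP idP) => [/card_gt0P[[x y]]|[x [y [Xx Yy xy]]]].
  by rewrite inE => /and3P[]; exists x, y.
exact: ec_gt0 xy.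
Qed.

Lemma ec_le1_inj X Y x y x' y' : ec X Y <= 1 ->
  x \in X -> y \in Y -> adj x y -> x' \in X -> y' \in Y -> adj x' y' ->
  x = x' /\ y = y'.
Proof.
move=> le1 Xx Yy xy Xx' Yy' xy'.
suff [] : (x, y) = (x', y') by [].
by apply: (card_le1_eqP le1); rewrite inE /= ?Xx ?Xx' ?Yy ?Yy'.
Qed.

Lemma ec_gt1 X Y x y x' y' : (x, y) != (x', y') ->
  x \in X -> y \in Y -> adj x y -> x' \in X -> y' \in Y -> adj x' y' ->
  1 < ec X Y.
Proof.
move=> neq Xx Yy xy Xx' Yy' xy'; rewrite ltnNge; apply/negP => le1.
by have [ex ey] := ec_le1_inj le1 Xx Yy xy Xx' Yy' xy'; rewrite ex ey eqxx in neq.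
Qed.

Lemma ec_even X : ~~ odd (ec X X).
Proof.
pose P := [set p : G * G | enum_rank p.1 < enum_rank p.2].
rewrite /ec -(cardsID P); set E := [set p | _].
suff -> : #|E :\: P| = #|E :&: P| by rewrite oddD addbb.
rewrite -(card_imset _ (inv_inj swapK)).
apply: eq_card => -[x y]; rewrite !inE /=.
apply/imsetP/idP => [[[u v]]|/andP[/and3P[Xx Xy xy] lt]].
  rewrite !inE /= => /andP[nlt /and3P[Xu Xv uv]] [-> ->].
  rewrite Xu Xv adj_sym uv /= ltn_neqAle leqNgt nlt andbT.
  by apply: contraTneq uv => /val_inj/enum_rank_inj->; rewrite adj_irrefl.
by exists (y, x); rewrite // !inE /= Xx Xy adj_sym xy -leqNgt ltnW.
Qed.

Lemma cutC X : cut (~: X) = cut X.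
Proof. by rewrite /cut setCK ecC. Qed.

Lemma ec_degree X : cubic G -> ec X setT = 3 * #|X|.
Proof.
move=> /forallP cub; rewrite /ec -sum1_card.
rewrite (eq_bigl (fun p : G * G => (p.1 \in X) && adj p.1 p.2)); last first.
  by move=> p; rewrite !inE.
rewrite -(pair_big_dep (mem X) (fun x y => adj x y) (fun _ _ => 1)) /=.
rewrite mulnC -sum_nat_const; apply: eq_bigr => x _.
by rewrite -(eqP (cub x)) -sum1_card; apply: eq_bigl => y; rewrite inE.
Qed.

Lemma odd_cut X : cubic G -> odd (cut X) = odd #|X|.
Proof.
move=> cub; have := ec_degree X cub; rewrite (ec_splitr X) setTI setTD -/(cut X).
by move=> e3; have := ec_even X; lia.
Qed.

Lemma uncross X Y :
  [/\ cut X = ec (X :&: Y) (Y :\: X) + ec (X :&: Y) (~: (X :|: Y))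
            + ec (X :\: Y) (Y :\: X) + ec (X :\: Y) (~: (X :|: Y)),
      cut Y = ec (X :&: Y) (X :\: Y) + ec (X :&: Y) (~: (X :|: Y))
            + ec (X :\: Y) (Y :\: X) + ec (Y :\: X) (~: (X :|: Y)) &
   [/\ cut (X :&: Y) = ec (X :&: Y) (X :\: Y) + ec (X :&: Y) (Y :\: X)
                     + ec (X :&: Y) (~: (X :|: Y)),
       cut (X :\: Y) = ec (X :&: Y) (X :\: Y) + ec (X :\: Y) (Y :\: X)
                     + ec (X :\: Y) (~: (X :|: Y)),
       cut (Y :\: X) = ec (X :&: Y) (Y :\: X) + ec (X :\: Y) (Y :\: X)
                     + ec (Y :\: X) (~: (X :|: Y)) &
       cut (X :|: Y) = ec (X :&: Y) (~: (X :|: Y))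
                     + ec (X :\: Y) (~: (X :|: Y))
                     + ec (Y :\: X) (~: (X :|: Y))]].
Proof.
set P := X :&: Y; set Q := X :\: Y; set R := Y :\: X; set O := ~: (X :|: Y).
have setE (W W' : {set G}) : (forall z, (z \in W) = (z \in W')) -> W = W'.
  by move/setP.
do 2?split.
- rewrite /cut (ec_splitl Y) (ec_splitr Y) (ec_splitr Y (X :\: Y)).
  have -> : ~: X :&: Y = R by apply: setE => z; rewrite !inE andbC.
  have -> : ~: X :\: Y = O by apply: setE => z; rewrite !inE negb_or andbC.
  by rewrite !addnA.
- rewrite /cut (ec_splitl X) (ec_splitr X) (ec_splitr X (Y :\: X)).
  have -> : ~: Y :&: X = Q by apply: setE => z; rewrite !inE.
  have -> : ~: Y :\: X = O by apply: setE => z; rewrite !inE negb_or.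
  by rewrite [Y :&: X]setIC -/P -/R (ecC R Q) !addnA.
- rewrite /cut (ec_splitr X) (ec_splitr Y _ (_ :\: X)) addnA.
  by congr (ec _ _ + ec _ _ + ec _ _); apply: setE => z; rewrite !inE;
    case: (z \in X); case: (z \in Y).
- rewrite /cut (ec_splitr X) (ec_splitr Y _ (_ :\: X)) addnA (ecC P Q).
  by congr (ec _ _ + ec _ _ + ec _ _); apply: setE => z; rewrite !inE;
    case: (z \in X); case: (z \in Y).
- rewrite /cut (ec_splitr Y) (ec_splitr X _ (_ :\: Y)) addnA (ecC P R) (ecC Q R).
  by congr (ec _ _ + ec _ _ + ec _ _); apply: setE => z; rewrite !inE;
    case: (z \in X); case: (z \in Y).
- rewrite /cut ecC (ec_splitr X) (ec_splitr Y _ (_ :&: X)) !(ecC _ O).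
  by congr (ec _ _ + ec _ _ + ec _ _); apply: setE => z; rewrite !inE;
    case: (z \in X); case: (z \in Y).
Qed.

(** Submodularity with its exact defect: every edge known to join the two differences improves the
    estimate by two. [cut_diff] is the same for posimodularity. *)
Lemma cut_cap_cup X Y :
  cut (X :&: Y) + cut (X :|: Y) + 2 * ec (X :\: Y) (Y :\: X) = cut X + cut Y.
Proof. by have [-> -> [-> _ _ ->]] := uncross X Y; lia. Qed.

Lemma cut_diff X Y :
  cut (X :\: Y) + cut (Y :\: X) + 2 * ec (X :&: Y) (~: (X :|: Y))
  = cut X + cut Y.
Proof. by have [-> -> [_ -> -> _]] := uncross X Y; lia. Qed.

End Cuts.

(* The cubic near-bipartite graphs: all edges except a1 a2 and b1 b2 join
   side to its complement. *)
Record frame (G : sgraph) := Frame {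
  side : {set G};
  a1 : G; a2 : G; b1 : G; b2 : G;
  frame_cubic : cubic G;
  cut_ge3 : forall (X : {set G}) x y, x \in X -> y \notin X -> 3 <= cut X;
  a1_side : a1 \in side;
  a2_side : a2 \in side;
  b1_side : b1 \in ~: side;
  b2_side : b2 \in ~: side;
  adj_a : adj a1 a2;
  adj_b : adj b1 b2;
  adj_side : forall x y, x \in side -> y \in side -> adj x y ->
    (x, y) \in [:: (a1, a2); (a2, a1)];
  adj_coside : forall x y, x \in ~: side -> y \in ~: side -> adj x y ->
    (x, y) \in [:: (b1, b2); (b2, b1)];
  card_side : #|side| = #|~: side|
}.

(** * The flow balance of a frame and its separating 3-edge cuts *)

Section Frames.
Variable G : sgraph.
Implicit Types (F : frame G) (X Y Z D : {set G}).

(** The symmetries of a frame are again frames, so an argument is given for one end and transported.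
    The definitions are transparent, which lets [/=] compute the new side and ends. *)
Definition swap_sides F : frame G.
refine (@Frame G (~: side F) (b1 F) (b2 F) (a1 F) (a2 F) (frame_cubic F)
  (@cut_ge3 G F) (b1_side F) (b2_side F) _ _ (adj_b F) (adj_a F)
  (@adj_coside G F) _ _); rewrite ?setCK ?card_side //.
- exact: a1_side.
- exact: a2_side.
- exact: adj_side.
Defined.

Definition swap_a F : frame G.
refine (@Frame G (side F) (a2 F) (a1 F) (b1 F) (b2 F) (frame_cubic F)
  (@cut_ge3 G F) (a2_side F) (a1_side F) (b1_side F) (b2_side F) _ (adj_b F)
  _ (@adj_coside G F) (card_side F)).
- by rewrite adj_sym adj_a.
- by move=> x y Ax Ay xy; have := adj_side Ax Ay xy; rewrite !inE orbC.
Defined.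

Definition swap_b F : frame G.
refine (@Frame G (side F) (a1 F) (a2 F) (b2 F) (b1 F) (frame_cubic F)
  (@cut_ge3 G F) (a1_side F) (a2_side F) (b2_side F) (b1_side F) (adj_a F) _
  (@adj_side G F) _ (card_side F)).
- by rewrite adj_sym adj_b.
- by move=> x y Bx By xy; have := adj_coside Bx By xy; rewrite !inE orbC.
Defined.

(** With every edge between the classes directed from [side F] to its complement, [out] counts the
    edges leaving [X] and [ins] those entering it. *)
Definition out F X := ec (X :&: side F) (~: X :\: side F).
Definition ins F X := ec (~: X :&: side F) (X :\: side F).

Lemma neq_a F : a1 F != a2 F.
Proof. by apply: contraTneq (adj_a F) => ->; rewrite adj_irrefl. Qed.

Lemma ec_side F X Y : ec (X :&: side F) (Y :&: side F) =
  ((a1 F \in X) && (a2 F \in Y)) + ((a2 F \in X) && (a1 F \in Y)).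
Proof.
rewrite /ec; set E := [set p | _].
have -> : E = [set p in [set (a1 F, a2 F); (a2 F, a1 F)]
    | (p.1 \in X) && (p.2 \in Y)].
  apply/setP => -[x y]; rewrite !inE /=.
  apply/idP/idP => [/and3P[/andP[-> Ax] /andP[-> Ay] xy]|].
    by have := adj_side Ax Ay xy; rewrite !inE => ->.
  case/andP=> /orP[] /eqP[-> ->] /andP[-> ->].
    by rewrite a1_side a2_side adj_a.
  by rewrite a1_side a2_side adj_sym adj_a.
rewrite -sum1dep_card big_mkcondr big_setU1 ?big_set1 /=; last first.
  by rewrite inE; apply: contra (neq_a F) => /eqP[->].
by do 2!case: (_ && _).
Qed.

Lemma ec_coside F X Y : ec (X :\: side F) (Y :\: side F) =
  ((b1 F \in X) && (b2 F \in Y)) + ((b2 F \in X) && (b1 F \in Y)).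
Proof. by rewrite !setDE; exact: (ec_side (swap_sides F)). Qed.

Definition sum_a F X := (a1 F \in X) + (a2 F \in X).
Definition sum_b F X := (b1 F \in X) + (b2 F \in X).

Lemma cutE F X : cut X = ins F X + out F X
  + ((a1 F \in X) (+) (a2 F \in X)) + ((b1 F \in X) (+) (b2 F \in X)).
Proof.
rewrite /cut (ec_splitl (side F)) !(ec_splitr (side F) _ (~: X)).
rewrite ec_side ec_coside -/(out F X) (ecC (X :\: _)) -/(ins F X) !inE.
by do 4!case: (_ \in X); rewrite /=; lia.
Qed.

Lemma count_side F X :
  3 * #|X :&: side F| = ec (X :&: side F) (X :\: side F) + out F X + sum_a F X.
Proof.
rewrite -(ec_degree _ (frame_cubic F)) (ec_splitr (side F)) ec_side !inE.
rewrite (ec_splitr X _ (_ :\: _)) /sum_a /out !andbT.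
have -> : ([set: G] :\: side F) :&: X = X :\: side F.
  by apply/setP => z; rewrite !inE andbT andbC.
have -> : ([set: G] :\: side F) :\: X = ~: X :\: side F.
  by apply/setP => z; rewrite !inE andbT andbC.
by lia.
Qed.

Lemma ins_swap F X : ins (swap_sides F) (~: X) = ins F X.
Proof.
rewrite /ins /= ecC.
by congr ec; apply/setP => z; rewrite !inE ?negbK // andbC.
Qed.

Lemma card_coside F X : #|~: X :&: side F| + #|X :&: side F|
  = #|~: X :\: side F| + #|X :\: side F|.
Proof.
have := card_side F; rewrite -(cardsID X (side F)) -(cardsID X (~: side F)).
have -> : side F :&: X = X :&: side F by rewrite setIC.
have -> : side F :\: X = ~: X :&: side F by rewrite setDE setIC.
have -> : ~: side F :&: X = X :\: side F by rewrite setDE setIC.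
have -> : ~: side F :\: X = ~: X :\: side F by rewrite !setDE setIC.
by lia.
Qed.

(** The degree sums of the two classes of [X] share the edges inside [X] that join the classes.
    Eliminating these gives the flow balance behind most numerical steps. *)
Lemma frame_count F X : ins F X + sum_b F X + 3 * #|X :&: side F|
  = out F X + sum_a F X + 3 * #|X :\: side F|.
Proof.
have eA := count_side F X.
have := count_side (swap_sides F) X.
have -> : out (swap_sides F) X = ins F X.
  by rewrite /out /ins /= ecC !setDE setCK.
rewrite /= (setDE X (~: _)) setCK -setDE ecC => eB.
by rewrite eA eB /sum_a /sum_b /=; lia.
Qed.

(* The 3-edge cuts that separate b1 b2 from a1 a2; they form a chain. *)
Definition Ecut F X :=
  [&& b1 F \in X, b2 F \in X, a1 F \notin X, a2 F \notin X & cut X == 3].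

Lemma Ecut_swap F X : Ecut (swap_sides F) (~: X) = Ecut F X.
Proof.
rewrite /Ecut cutC /= !inE !negbK.
by do 4!case: (_ \in X); rewrite /= ?andbF.
Qed.

Lemma Ecut_swap_a F X : Ecut (swap_a F) X = Ecut F X.
Proof. by rewrite /Ecut /=; do 4!case: (_ \in X). Qed.

(** Modulo 3 the flow balance excludes every other split of the three cut edges. The single leaving
    edge is the source of the forced edges. *)
Lemma Ecut_count F X : Ecut F X ->
  [/\ ins F X = 2, out F X = 1 & #|X :\: side F| = #|X :&: side F| + 1].
Proof.
case/and5P=> b1X b2X a1X a2X /eqP d3.
have := cutE F X; have := frame_count F X; rewrite /sum_a /sum_b d3.
by rewrite b1X b2X (negPf a1X) (negPf a2X) /=; split; lia.
Qed.

Lemma Ecut_le3 F X : b1 F \in X -> b2 F \in X -> a1 F \notin X ->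
  a2 F \notin X -> cut X <= 3 -> Ecut F X.
Proof.
move=> b1X b2X a1X a2X d3; rewrite /Ecut b1X b2X a1X a2X eqn_leq d3.
exact: cut_ge3 b1X a1X.
Qed.

Lemma cut_ge4 F X x y : x \in X -> y \notin X -> ~~ odd #|X| -> 4 <= cut X.
Proof.
move=> Xx Xy; rewrite -(odd_cut _ (frame_cubic F)) => even.
have := cut_ge3 F Xx Xy; rewrite leq_eqVlt => /orP[/eqP d3|//].
by rewrite -d3 in even.
Qed.

(** If neither contained the other, the intersection would have a cut of exactly 3 edges, so it
    would be odd, as are [X] and [Y]. Both differences would then be even, with cuts of at least 4 +
    4 > 3 + 3 edges. *)
Lemma Ecut_nested F X Y : Ecut F X -> Ecut F Y -> X \subset Y \/ Y \subset X.
Proof.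
case/and5P=> b1X b2X a1X a2X /eqP dX /and5P[b1Y b2Y a1Y a2Y /eqP dY].
have [|/set0Pn[x Xx]] := boolP (X :\: Y == set0).
  by rewrite setD_eq0; left.
have [|/set0Pn[y Yy]] := boolP (Y :\: X == set0).
  by rewrite setD_eq0; right.
have := cut_cap_cup X Y; have := cut_diff X Y; rewrite dX dY => diff cap_cup.
have dI : 3 <= cut (X :&: Y).
  by apply: (@cut_ge3 _ F _ (b1 F) (a1 F)); rewrite inE ?b1X // (negPf a1X).
have dU : 3 <= cut (X :|: Y).
  by apply: (@cut_ge3 _ F _ (b1 F) (a1 F)); rewrite inE ?b1X // negb_or a1X.
have dI3 : cut (X :&: Y) = 3 by move: cap_cup dI dU; clear; lia.
have oddI : odd #|X :&: Y| by rewrite -(odd_cut _ (frame_cubic F)) dI3.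
have oddX : odd #|X| by rewrite -(odd_cut _ (frame_cubic F)) dX.
have oddY : odd #|Y| by rewrite -(odd_cut _ (frame_cubic F)) dY.
have dD : 4 <= cut (X :\: Y).
  apply: (@cut_ge4 F _ x (b1 F)); rewrite // ?inE ?b1Y //.
  by move: oddX; rewrite -(cardsID Y X) oddD oddI; case: odd.
have dD' : 4 <= cut (Y :\: X).
  apply: (@cut_ge4 F _ y (b1 F)); rewrite // ?inE ?b1X //.
  by move: oddY; rewrite -(cardsID X Y) oddD setIC oddI; case: odd.
by move: cap_cup diff dI dU dD dD'; clear; lia.
Qed.

End Frames.

(** * Tight sets and exceptional edges *)

Section Witnesses.
Variable G : sgraph.
Implicit Types (F : frame G) (X Y Z D O : {set G}) (u v x y : G).

Lemma card_side_split F X Y :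
  #|X :&: side F| = #|X :&: Y :&: side F| + #|(X :\: Y) :&: side F|.
Proof. by rewrite -(cardsID Y) setIAC setIDAC. Qed.

Lemma card_coside_split F X Y :
  #|X :\: side F| = #|(X :&: Y) :\: side F| + #|(X :\: Y) :\: side F|.
Proof.
by rewrite -(cardsID Y) setIDAC !setDDl setUC.
Qed.

Lemma out_gt0 F D u v : u \in side F -> v \notin side F -> adj u v ->
  u \in D -> v \notin D -> 0 < out F D.
Proof.
by move=> Au Bv uv Du Dv; apply: (@ec_gt0 _ _ _ u v);
  rewrite ?inE ?Du ?Dv ?Au ?Bv.
Qed.

Lemma ins_gt0 F D u v : u \in side F -> v \notin side F -> adj u v ->
  u \notin D -> v \in D -> 0 < ins F D.
Proof.
by move=> Au Bv uv Du Dv; apply: (@ec_gt0 _ _ _ u v);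
  rewrite ?inE ?Du ?Dv ?Au ?Bv.
Qed.

(** Besides a1 a2 the cut has two edges, and modulo 3 the flow balance makes both of them leave
    [O]. *)
Lemma tight_a F O : a1 F \in O -> a2 F \notin O -> b1 F \notin O ->
  b2 F \notin O -> cut O <= 3 ->
  ins F O = 0 /\ #|O :&: side F| = #|O :\: side F| + 1.
Proof.
move=> a1O a2O b1O b2O d3; have {}d3 : cut O = 3.
  by apply/eqP; rewrite eqn_leq d3 (cut_ge3 F a1O a2O).
have := cutE F O; have := frame_count F O; rewrite /sum_a /sum_b d3.
rewrite a1O (negPf b1O) (negPf b2O) (negPf a2O) /=.
by move: (ins _ _) (out _ _) #|_| #|_|; clear; lia.
Qed.

Lemma tight_ins F O : a1 F \in O -> a2 F \notin O -> b1 F \notin O ->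
  b2 F \notin O -> cut O <= 3 -> ins F O = 0.
Proof. by move=> a1O a2O b1O b2O /(tight_a a1O a2O b1O b2O)[]. Qed.

(* Besides a1 a2 and uv, the cut of O has one more edge, which goes to Z. *)
Definition exceptional F Z u v := exists O : {set G},
  [/\ a1 F \in O, a2 F \notin O, [disjoint O & Z], cut O = 3 &
      [/\ u \in O, v \notin O, v \notin Z & 0 < ec O Z]].

(** The set [O] is unique: for two such sets a1 a2, and for nested ones also the edge to [Z], runs
    from the intersection to the outside of the union, which [cut_diff] does not allow. In its cut,
    a1 a2 and the edge to [Z] leave room for one more edge. *)
Lemma exceptional_inj F Z u v u' v' : Ecut F Z ->
  v \notin side F -> adj u v -> v' \notin side F -> adj u' v' ->
  exceptional F Z u v -> exceptional F Z u' v' -> u = u' /\ v = v'.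
Proof.
move=> EZ Bv uv Bv' uv'.
have [_ _ _ a2Z _] := and5P EZ.
have sub O O' : a1 F \in O -> a2 F \notin O' -> [disjoint O' & Z] ->
    cut O = 3 -> cut O' = 3 -> 0 < ec O Z -> O \subset O' -> O = O'.
  move=> a1O a2O' dO' dO dO3' /ec_gt0P[x [y [Ox Zy xy]]] sOO'.
  apply/eqP; rewrite eqEsubset sOO' /=; apply/subsetP => z O'z.
  apply/negPn/negP => Oz; have := cut_diff O O'.
  have -> : cut (O :\: O') = 0.
    have/eqP-> : O :\: O' == set0 by rewrite setD_eq0.
    by apply/eqP; rewrite -leqn0 leqNgt; apply/negP => /ec_gt0P[? [? []]];
      rewrite inE.
  have : 3 <= cut (O' :\: O).
    by apply: (@cut_ge3 _ F _ z (a1 F)); rewrite inE ?O'z ?a1O // Oz.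
  suff : 1 < ec (O :&: O') (~: (O :|: O')) by rewrite dO dO3'; clear; lia.
  have O'y : y \notin O' by apply: contraL Zy => /(disjointFr dO')->.
  apply: (@ec_gt1 _ _ _ (a1 F) (a2 F) x y); rewrite ?inE ?a1O ?Ox ?adj_a //.
  - by apply: contraNneq a2Z => -[_ ->].
  - exact: (subsetP sOO').
  - by rewrite negb_or a2O' andbT; apply: contra a2O'; apply: (subsetP sOO').
  - exact: (subsetP sOO').
  - by rewrite negb_or O'y andbT; apply: contra O'y; apply: (subsetP sOO').
case=> O [a1O a2O dO dO3 [Ou Ov Zv eO]] [O' [a1O' a2O' dO' dO3' [Ou' Ov' Zv' eO']]].
have eOO' : O = O'.
  have [|/set0Pn[x Xx]] := boolP (O :\: O' == set0).
    by rewrite setD_eq0; exact: sub.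
  have [|/set0Pn[y Yy]] := boolP (O' :\: O == set0).
    by rewrite setD_eq0 => s; apply/esym/sub.
  have : 3 <= cut (O :\: O').
    by apply: (@cut_ge3 _ F _ x (a1 F)); rewrite // inE a1O'.
  have : 3 <= cut (O' :\: O).
    by apply: (@cut_ge3 _ F _ y (a1 F)); rewrite // inE a1O.
  have : 0 < ec (O :&: O') (~: (O :|: O')).
    apply: (@ec_gt0 _ _ _ (a1 F) (a2 F)); rewrite ?adj_a // !inE ?a1O //.
    by rewrite negb_or a2O.
  by have := cut_diff O O'; rewrite dO3 dO3'; clear; lia.
rewrite -eOO' in Ou' Ov'.
suff le1 : ec O ((~: O :\: Z) :\: side F) <= 1.
  by apply: (ec_le1_inj le1 Ou _ uv Ou' _ uv'); rewrite !inE ?Bv ?Bv' ?Zv ?Zv'.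
have : 0 < ec O ((~: O :\: Z) :&: side F).
  by apply: (ec_gt0 a1O _ (adj_a F)); rewrite !inE a2Z a2O a2_side.
move: dO3; rewrite /cut (ec_splitr Z) (ec_splitr (side F) _ (_ :\: Z)).
have -> : ~: O :&: Z = Z.
  by apply/setIidPr; rewrite -disjoints_subset disjoint_sym.
by move: eO; move: (ec _ _) (ec _ _) (ec _ _); clear; lia.
Qed.

(** By parity [Z :\: D] or [D :&: Z] has a cut of at least 4 edges. In the first case [D :\: Z] is
    tight and cannot be entered by uv; in the second the complement of [D :|: Z] is the required
    set. *)
Lemma cross_exceptional F D Z u v x y :
  a2 F \in D -> a1 F \notin D -> cut D = 4 -> ins F D = 1 -> Ecut F Z ->
  x \in D :&: Z -> y \in Z :\: D ->
  u \in side F -> v \notin side F -> adj u v ->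
  u \notin D -> v \in D -> u \notin Z -> v \notin Z -> exceptional F Z u v.
Proof.
move=> a2D a1D dD iD EZ xI yR Au Bv uv Du Dv Zu Zv.
have [b1Z b2Z a1Z a2Z /eqP dZ] := and5P EZ.
have evD : odd #|D| = false by rewrite -(odd_cut _ (frame_cubic F)) dD.
have oddZ : odd #|Z| by rewrite -(odd_cut _ (frame_cubic F)) dZ.
have := cut_cap_cup D Z; have := cut_diff D Z; rewrite dD dZ => diff cap.
have [oddI|evI] := boolP (odd #|D :&: Z|).
  have dR : 4 <= cut (Z :\: D).
    apply: (@cut_ge4 _ F _ y (a1 F)) => //; first by rewrite inE (negPf a1Z) andbF.
    by move: oddZ; rewrite -(cardsID D Z) oddD setIC oddI; case: odd.
  have i0 : ins F (D :\: Z) = 0.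
    apply: (@tight_ins (swap_a F)); rewrite ?inE ?a2D ?a2Z ?b1Z ?b2Z //=.
      by rewrite (negPf a1D) andbF.
    by move: diff dR; clear; lia.
  have := @ins_gt0 F (D :\: Z) u v Au Bv uv.
  by rewrite !inE (negPf Du) andbF Zv Dv i0 => /(_ isT isT).
have dI : 4 <= cut (D :&: Z).
  by apply: (@cut_ge4 _ F _ x (a1 F)) => //; rewrite inE (negPf a1D).
set O := ~: (D :|: Z).
have dO : cut O <= 3 by rewrite cutC; move: cap dI; clear; lia.
have OP z : (z \in O) = (z \notin D) && (z \notin Z) by rewrite !inE negb_or.
have iO : ins F O = 0.
  by apply: tight_ins; rewrite // OP ?a1D ?a2D ?b1Z ?b2Z ?andbF.
have dO3 : cut O = 3.
  apply/eqP; rewrite eqn_leq dO (@cut_ge3 _ F _ (a1 F) (a2 F)) // OP ?a2D //.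
  by rewrite a1D.
exists O; split=> //; rewrite ?OP ?a1D ?a2D //.
  by rewrite disjoints_subset; apply/subsetP => z; rewrite OP inE => /andP[].
split; rewrite ?OP ?Du ?Dv // lt0n.
(* Without an edge to [Z], all three cut edges of [O] would go to [D :\: Z]. But these are a1 a2,
   none that enters [O], and at most one that leaves it, since only one edge enters [D]. *)
apply/negP => /eqP eOZ.
move: dO3; rewrite /cut (ec_splitr Z) /O setCK.
have -> : (D :|: Z) :&: Z = Z.
  by apply/setP => z; rewrite !inE andb_idl // => ->; rewrite orbT.
have -> : (D :|: Z) :\: Z = D :\: Z.
  by apply/setP => z; rewrite !inE; case: (z \in Z); rewrite ?orbF.
rewrite -/O eOZ (ec_splitr (side F)) (ec_splitl (side F) O).
rewrite (ec_splitl (side F) O (_ :\: side F)) ec_side ec_coside.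
rewrite !OP (negPf a1D) a2D b1Z b2Z !inE a1Z a2D a2Z (negPf a1D) ?andbF /=.
have : ec (O :\: side F) ((D :\: Z) :&: side F) <= ins F O.
  rewrite /ins ecC; apply: ec_sub => //.
  apply/subsetP => z; rewrite !in_setI in_setC OP in_setD.
  by case/andP=> /andP[_ ->] ->.
have : ec (O :&: side F) ((D :\: Z) :\: side F) <= ins F D.
  rewrite /ins; apply: ec_sub.
    apply/subsetP => z; rewrite !in_setI in_setC OP.
    by case/andP=> /andP[-> _] ->.
  by apply/subsetP => z; rewrite !inE => /and3P[-> _ ->].
by rewrite iO iD; move: (ec _ _) (ec _ _); clear; lia.
Qed.

Lemma cut_split X Y :
  cut (X :&: Y) + cut (X :\: Y) = 2 * ec (X :&: Y) (X :\: Y) + cut X.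
Proof. by have [-> _ [-> -> _ _]] := uncross X Y; clear; lia. Qed.

(** Each of the two parts of [Z] contains one of b1, b2 and has a cut of at least 3 edges, while the
    cut of [Z] supplies only 3 of these 6. *)
Lemma split_Ecut F D Z : Ecut F Z -> (b1 F \in D) != (b2 F \in D) ->
  2 <= ec (Z :&: D) (Z :\: D).
Proof.
move=> /and5P[b1Z b2Z a1Z a2Z /eqP dZ] bD.
have dP (X : {set G}) x : x \in X -> X \subset Z -> 3 <= cut X.
  move=> Xx sXZ; apply: (@cut_ge3 _ F _ x (a1 F)) => //.
  by apply: contra a1Z; apply: (subsetP sXZ).
have : 3 <= cut (Z :&: D) /\ 3 <= cut (Z :\: D).
  have [b1D|b1D] := boolP (b1 F \in D); rewrite ?b1D ?(negPf b1D) in bD.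
    split; first by apply: (dP _ (b1 F)); rewrite ?subsetIl // inE b1Z.
    by apply: (dP _ (b2 F)); rewrite ?subsetDl // inE b2Z; case: (b2 F \in D) bD.
  split; first by apply: (dP _ (b2 F)); rewrite ?subsetIl // inE b2Z; case: (b2 F \in D) bD.
  by apply: (dP _ (b1 F)); rewrite ?subsetDl // inE b1Z b1D.
by have := cut_split Z D; rewrite dZ => + []; clear; lia.
Qed.

End Witnesses.

(** * Certificates with four edges and their position relative to a 3-edge cut *)

Section Blocking.
Variable G : sgraph.
Implicit Types (F : frame G) (X Y Z D O : {set G}) (u v x y : G) (mu : G -> G).

Definition unsep F u v :=
  [forall Z : {set G}, Ecut F Z ==> ((u \in Z) == (v \in Z))].

Definition witness F D u v :=
  [&& u \notin D, v \in D, cut D == 4 & #|D :&: side F| == #|D :\: side F|].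

Lemma unsepP F u v :
  reflect (forall Z, Ecut F Z -> (u \in Z) = (v \in Z)) (unsep F u v).
Proof.
apply: (iffP forallP) => uv Z; first by move=> EZ; have/implyP/(_ EZ)/eqP := uv Z.
by apply/implyP => /uv->.
Qed.

Lemma unsep_swap_a F u v : unsep (swap_a F) u v = unsep F u v.
Proof. by apply: eq_forallb => Z; rewrite Ecut_swap_a. Qed.

Lemma witness_swap F D u v :
  witness (swap_sides F) (~: D) v u = witness F D u v.
Proof.
have eA : ~: D :\: ~: side F = ~: D :&: side F by rewrite setDE setCK.
rewrite /witness cutC !inE negbK /= eA -setDE.
case: (u \in D); case: (v \in D) => //=; congr (_ && _).
have := card_coside F D; move: #|_| #|_| #|_| #|_|; clear=> a b c d.
by move=> e; apply/eqP/eqP; lia.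
Qed.

Lemma witness_count F D u v : witness F D u v ->
  [/\ ins F D + sum_b F D = out F D + sum_a F D, cut D = 4 &
    ins F D + out F D + ((a1 F \in D) (+) (a2 F \in D))
    + ((b1 F \in D) (+) (b2 F \in D)) = 4].
Proof.
case/and4P=> _ _ /eqP d4 /eqP card; have := frame_count F D.
by have := cutE F D; rewrite d4 card; split=> //; lia.
Qed.

Lemma witness_ins_out F D u v : witness F D u v ->
  sum_a F D <= 1 -> 0 < sum_b F D ->
  ins F D = 1 /\ out F D + sum_a F D = 1 + sum_b F D.
Proof.
case/witness_count; rewrite /sum_a /sum_b => + _.
move: (ins F D) (out F D) => i o; move: (_ \in D) (_ \in D) (_ \in D) (_ \in D).
by case; case; case; case; rewrite //=; clear; lia.
Qed.

(** For odd [D :&: Z] uncrossing makes [D :\: Z] tight, so [v] lies in [D :&: Z], which is then a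
    3-edge cut separating [u] from [v]. For even [D :&: Z] the cut estimates are equalities and the
    class sizes decide. *)
Lemma block12_outside F D Z u v y :
  witness F D u v -> a2 F \in D -> a1 F \notin D -> b1 F \in D -> b2 F \in D ->
  Ecut F Z -> unsep F u v -> y \in Z :\: D ->
  u \in side F -> v \notin side F -> adj u v -> v \notin Z.
Proof.
move=> wD a2D a1D b1D b2D EZ /unsepP uvZ yR Au Bv uv.
have [Du Dv _ /eqP balD] := and4P wD.
have [_ d4 _] := witness_count wD.
have [b1Z b2Z a1Z a2Z /eqP dZ] := and5P EZ.
have oddZ : odd #|Z| by rewrite -(odd_cut _ (frame_cubic F)) dZ.
have := cut_cap_cup D Z; have := cut_diff D Z; rewrite d4 dZ => diff cap.
have evD : odd #|D| = false by rewrite -(odd_cut _ (frame_cubic F)) d4.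
have ab z : z \in D -> z \notin D :\: Z -> z \in D :&: Z.
  by move=> Dz; rewrite !inE Dz andbT negbK.
have [oddI|evI] := boolP (odd #|D :&: Z|).
  have evU : ~~ odd #|D :|: Z|.
    have := cardsUI D Z => /(congr1 odd); rewrite !oddD evD oddZ oddI.
    by case: odd.
  have dU : 4 <= cut (D :|: Z).
    by apply: (@cut_ge4 _ F _ (b1 F) (a1 F)); rewrite // !inE ?b1D // negb_or a1D.
  have dR : 4 <= cut (Z :\: D).
    apply: (@cut_ge4 _ F _ y (a1 F)) => //; first by rewrite inE (negPf a1Z) andbF.
    by move: oddZ; rewrite -(cardsID D Z) oddD setIC oddI; case: odd.
  have i0 : ins F (D :\: Z) = 0.
    apply: (@tight_ins _ (swap_a F)); rewrite ?inE ?a2D ?a2Z ?b1Z ?b2Z //=.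
      by rewrite (negPf a1D) andbF.
    by move: diff dR; clear; lia.
  have Iv : v \in D :&: Z.
    apply: ab => //; apply/negP => DZv.
    have := @ins_gt0 _ F (D :\: Z) u v Au Bv uv _ DZv.
    by rewrite inE (negPf Du) andbF i0 => /(_ isT).
  have EI : Ecut F (D :&: Z).
    apply: Ecut_le3; rewrite ?inE ?b1D ?b2D ?(negPf a1D) ?(negPf a2Z) ?andbF //.
    by move: cap dU; clear; lia.
  by have := uvZ _ EI; rewrite Iv inE (negPf Du).
have dI : 4 <= cut (D :&: Z).
  by apply: (@cut_ge4 _ F _ (b1 F) (a1 F)); rewrite // !inE ?b1D // (negPf a1D).
have dU : 3 <= cut (D :|: Z).
  by apply: (@cut_ge3 _ F _ (b1 F) (a1 F)); rewrite !inE ?b1D // negb_or a1D.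
have dQ : 4 <= cut (D :\: Z).
  apply: (@cut_ge4 _ F _ (a2 F) (a1 F)); rewrite ?inE ?a2D ?a2Z //.
    by rewrite (negPf a1D) andbF.
  move/negbT: evD; rewrite -(cardsID Z D) oddD.
  by case: (odd #|D :&: Z|) evI; case: odd.
have dR : 3 <= cut (Z :\: D).
  by apply: (@cut_ge3 _ F _ y (a1 F)); rewrite // inE (negPf a1Z) andbF.
(* If [v] lay in [Z], then uv would leave [Z :\: D], so all three cut edges of this set would leave
   it and it would have one more vertex in the side than outside. As [D :\: Z] is balanced, the
   sizes in [D] and in [Z] would give different values for [D :&: Z]. *)
apply/negP => Zv; have Zu : u \in Z by rewrite (uvZ _ EZ).
have := @out_gt0 _ F (Z :\: D) u v Au Bv uv.
rewrite !inE Zu Du Dv => /(_ isT isT).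
have := cutE F (Z :\: D); have := frame_count F (Z :\: D).
have := cutE F (D :\: Z); have := frame_count F (D :\: Z).
rewrite /sum_a /sum_b !inE b1D b2D a1Z a2Z b1Z b2Z a2D (negPf a1D) (negPf a2Z) (negPf a1Z) /=.
have [_ _ card] := Ecut_count EZ.
have := card_side_split F Z D; have := card_coside_split F Z D.
have := card_side_split F D Z; have := card_coside_split F D Z.
rewrite [Z :&: D]setIC.
move: diff cap dI dU dQ dR card balD; clear.
move: (ins _ _) (ins _ _) (out _ _) (out _ _) (cut _) (cut _) (cut _) (cut _).
move: (ec _ _) (ec _ _).
move: #|_| #|_| #|_| #|_| #|_| #|_| #|_| #|_| #|_| #|_|; clear.
by lia.
Qed.

(** The obstacle to leaving a1 uncovered: a certificate that contains all of [Z], such that every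
    edge leaving [Z] leaves it too. *)
Definition trapped F Z := [exists D : {set G}, exists u, exists v,
  [&& Z \subset D, a1 F \in D, a2 F \notin D, b1 F \in D & b2 F \in D] &&
  [&& witness F D u v, unsep F u v, u \in side F, v \notin side F, adj u v &
   [forall p in Z :&: side F, forall q in ~: Z :\: side F,
     adj p q ==> (q \notin D)]]].

(** Take a certificate [D] for a1 and [D'] for a2. The edge leaving [Z] leaves both, and a1 a2 joins
    their differences. So [D :\: D'] is tight, [v] lies in [D :&: D'], and this intersection is a
    3-edge cut separating [u] from [v]. *)
Lemma trapped_swap_a F Z : Ecut F Z -> trapped F Z -> trapped (swap_a F) Z -> False.
Proof.
move=> EZ /existsP[D /existsP[u /existsP[v /andP[]]]].
case/and5P=> sZD a1D a2D b1D b2D /and5P[wD uvZ Au Bv /andP[uv leave]].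
case/existsP=> D' /existsP[u' /existsP[v' /andP[]]] /=.
case/and5P=> sZD' a2D' a1D' b1D' b2D' /and5P[wD' uvZ' Au' Bv' /andP[uv' leave']].
have [Du Dv _ _] := and4P wD.
have [_ d4 _] := witness_count wD; have [_ d4' _] := witness_count wD'.
have [_ oZ _] := Ecut_count EZ.
have /ec_gt0P[p [q [Zp Zq pq]]] : 0 < out F Z by rewrite oZ.
have Dq : q \notin D.
  by move/forall_inP: leave => /(_ p Zp)/forall_inP/(_ q Zq)/implyP/(_ pq).
have D'q : q \notin D'.
  by move/forall_inP: leave' => /(_ p Zp)/forall_inP/(_ q Zq)/implyP/(_ pq).
have {}Zp : p \in Z by move: Zp; rewrite inE => /andP[].
have := cut_cap_cup D D'; have := cut_diff D D'; rewrite d4 d4'.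
have : 0 < ec (D :\: D') (D' :\: D).
  by apply: (@ec_gt0 _ _ _ (a1 F) (a2 F)); rewrite ?inE ?a1D ?a2D' ?a1D' ?a2D ?adj_a.
have : 0 < ec (D :&: D') (~: (D :|: D')).
  apply: (@ec_gt0 _ _ _ p q); rewrite ?inE ?negb_or ?Dq ?D'q //.
  by rewrite (subsetP sZD) ?(subsetP sZD').
have : 3 <= cut (D :|: D').
  by apply: (@cut_ge3 _ F _ (a1 F) q); rewrite !inE ?a1D // negb_or Dq.
have : 3 <= cut (D' :\: D).
  by apply: (@cut_ge3 _ F _ (a2 F) (a1 F)); rewrite !inE ?a2D ?a2D' // a1D.
move=> c1 c2 c3 c4 c5 c6.
have i0 : ins F (D :\: D') = 0.
  apply: tight_ins; rewrite ?inE ?a1D ?a1D' ?b1D' ?b2D' //.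
    by rewrite (negPf a2D) andbF.
  by move: c1 c2 c3 c4 c5 c6; clear; lia.
have Iv : v \in D'.
  apply/negPn/negP => D'v; have := @ins_gt0 _ F (D :\: D') u v Au Bv uv.
  by rewrite !inE (negPf Du) andbF Dv D'v i0 => /(_ isT isT).
have EI : Ecut F (D :&: D').
  apply: Ecut_le3; rewrite ?inE ?b1D ?b2D ?b1D' ?b2D' ?(negPf a1D') ?(negPf a2D) ?andbF //.
  by move: c1 c2 c3 c4 c5 c6; clear; lia.
by have := (unsepP _ _ _ uvZ) _ EI; rewrite !inE Dv Iv (negPf Du).
Qed.

End Blocking.

(** * Matchings that avoid the 3-edge cuts, and the certificates they cross *)

Section Pairings.
Variable G : sgraph.
Implicit Types (F : frame G) (X Y Z D O : {set G}) (u v x y : G) (mu : G -> G).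

(* A matching as an involution whose fixed points are the uncovered vertices. *)
Record pairing F mu : Prop := Pairing {
  pairing_inv : involutive mu;
  pairing_adj : forall x, mu x != x -> adj x (mu x);
  pairing_side : forall x, mu x != x -> (mu x \in side F) = (x \notin side F)
}.

Lemma flow F mu D : pairing F mu ->
  #|[set x in D :&: side F | mu x \notin D]|
    + #|[set x in D :\: side F | mu x != x]|
  = #|[set x in side F :\: D | mu x \in D]|
    + #|[set x in D :&: side F | mu x != x]|.
Proof.
case=> inv _ flip; have injm := inv_inj inv.
have eA : #|[set x in D :&: side F | mu x != x]|
  = #|[set x in D :&: side F | mu x \notin D]|
    + #|[set x in D :&: side F | (mu x \in D) && (mu x != x)]|.
  rewrite addnC -(cardsID [set x | mu x \in D]); congr (_ + _); apply: eq_card => x.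
    by rewrite !inE; case: (mu x \in D); rewrite ?andbT ?andbF.
  rewrite !inE; case Dmx: (mu x \in D); case Dx: (x \in D) => //=; rewrite ?andbT ?andbF //.
  by case: eqP => [eq|] //=; rewrite ?andbT //; rewrite eq Dx in Dmx.
have eB : #|[set x in D :\: side F | mu x != x]|
  = #|[set x in side F :\: D | mu x \in D]|
    + #|[set x in D :&: side F | (mu x \in D) && (mu x != x)]|.
  rewrite -(card_imset [set x in side F :\: D | mu x \in D] injm).
  rewrite -(card_imset [set x in D :&: side F | _ && _] injm).
  rewrite addnC -(cardsID [set x | mu x \in D]); congr (_ + _); apply: eq_card => x.
    rewrite !inE; apply/idP/imsetP => [/andP[/andP[/andP[Ax Dx] mx] Dmx]|[y]].
      exists (mu x); last by rewrite inv.
      by rewrite !inE Dmx flip // Ax inv Dx eq_sym.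
    rewrite !inE => /and3P[/andP[Dy Ay] Dmy my] ->.
    by rewrite flip // Ay Dmy inv eq_sym my Dy.
  rewrite !inE; apply/idP/imsetP => [/and3P[Dmx /andP[Ax Dx] mx]|[y]].
    exists (mu x); last by rewrite inv.
    by rewrite !inE Dmx flip // Ax inv Dx.
  rewrite !inE => /andP[/andP[Dy Ay] Dmy] ->.
  have my : mu y != y by apply: contraNneq Dy => <-.
  by rewrite inv Dy flip // Ay Dmy eq_sym my.
by rewrite eA eB addnCA addnA.
Qed.

(** Only a1 and b1 are uncovered; the other choices of i and j are reached by exchanging the ends in
    the frame. *)
Record near_perfect F mu : Prop := NearPerfect {
  near_pairing : pairing F mu;
  near_fixed : forall x, (mu x == x) = (x \in [:: a1 F; b1 F]);
  near_Ecut : forall Z x, Ecut F Z -> (mu x \in Z) = (x \in Z)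
}.

Lemma near_swap F mu : near_perfect F mu -> near_perfect (swap_sides F) mu.
Proof.
case=> [[inv madj flip]] fixed avoid; split=> [|x|Z x EZ].
- split=> // x mx; rewrite /= !inE flip //.
- by rewrite fixed !inE orbC.
by have := avoid (~: Z) x; rewrite -Ecut_swap setCK !inE => /(_ EZ)/negb_inj.
Qed.

Lemma near_flow F mu D : near_perfect F mu ->
  #|[set x in D :&: side F | mu x \notin D]|
    + (#|D :\: side F| + (a1 F \in D))
  = #|[set x in side F :\: D | mu x \in D]|
    + (#|D :&: side F| + (b1 F \in D)).
Proof.
case=> pmu fixed _; have := flow D pmu.
have a1F := a1_side F; have := b1_side F; rewrite inE => b1F.
have -> : [set x in D :&: side F | mu x != x] = (D :&: side F) :\ a1 F.
  apply/setP => x; rewrite !inE fixed !inE.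
  case: eqVneq => [->|_] /=; rewrite ?andbF //.
  by case: eqVneq => [->|_] /=; rewrite ?andbT ?andbF ?(negPf b1F) ?andbF.
have -> : [set x in D :\: side F | mu x != x] = (D :\: side F) :\ b1 F.
  apply/setP => x; rewrite !inE fixed !inE.
  case: eqVneq => [->|_] /=; rewrite ?a1F /= ?andbF //.
  by case: eqVneq => [->|_] /=; rewrite ?andbT ?andbF.
rewrite [#|D :&: side F|](cardsD1 (a1 F)) [#|D :\: side F|](cardsD1 (b1 F)).
rewrite !inE a1F b1F andbT /=.
by move: #|_| #|_| #|_| #|_|; clear=> a b c d; lia.
Qed.

Lemma inflow_le F mu D : pairing F mu ->
  #|[set x in side F :\: D | mu x \in D]| <= ins F D.
Proof.
case=> inv madj flip; rewrite /ins /ec.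
have inj : injective (fun x => (x, mu x)) by move=> x y [].
rewrite -(card_imset _ inj); apply/subset_leq_card/subsetP => p /imsetP[x].
rewrite !inE => /andP[/andP[Dx Ax] Dmx] -> /=.
have mx : mu x != x by apply: contraNneq Dx => <-.
by rewrite Dx Ax Dmx flip // Ax madj.
Qed.

(* x y is the only edge leaving X on the side of x, hence it lies in every
   perfect matching through a1 a2 and b1 b2. *)
Definition forced F x y := [&& x \in side F, y \notin side F, adj x y &
  [exists X : {set G}, [&& Ecut F X, x \in X & y \notin X]]].

Definition leaving F D := [set p : G * G |
  [&& forced F p.1 p.2, p.1 \in D & p.2 \notin D]].

(** A forced edge lies in a 3-edge cut and [mu] avoids these cuts, so the two kinds of leaving edges
    are disjoint. *)
Lemma outflow_le F mu D : near_perfect F mu ->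
  #|[set x in D :&: side F | mu x \notin D]| + #|leaving F D| <= out F D.
Proof.
case=> [[inv madj flip]] _ avoid; rewrite /out /ec.
have inj : injective (fun x => (x, mu x)) by move=> x y [].
rewrite -(card_imset [set x in _ | _] inj).
rewrite -cardsUI; set I := imset _ _.
have -> : I :&: leaving F D = set0.
  apply/setP => p; rewrite !inE; apply/negP => /andP[/imsetP[x _ ->]] /=.
  case/andP=> /and4P[_ _ _ /existsP[X /and3P[EX Xx nX]]] _.
  by rewrite avoid // Xx in nX.
rewrite cards0 addn0; apply/subset_leq_card/subsetP => p.
rewrite !inE => /orP[/imsetP[x]|/and3P[/and4P[-> Bp -> _] -> ->]].
  rewrite !inE => /andP[/andP[Dx Ax] Dmx] -> /=.
  have mx : mu x != x by apply: contraNneq Dmx => ->.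
  by rewrite Dx Ax Dmx flip // Ax madj.
by rewrite Bp.
Qed.

(* A near-perfect matching uses no forced edge, so the edges that leave D are
   too few unless D contains the right uncovered vertices. *)
Lemma near_witness F mu D u : near_perfect F mu -> u \in side F ->
  witness F D u (mu u) ->
  1 + (b1 F \in D) + #|leaving F D| <= out F D + (a1 F \in D).
Proof.
move=> nmu Au /and4P[Du Dv _ /eqP bal].
have := near_flow D nmu; have := outflow_le D nmu; rewrite bal.
have : 0 < #|[set x in side F :\: D | mu x \in D]|.
  by apply/card_gt0P; exists u; rewrite !inE Du Au.
by move: (out _ _) #|_| #|_| #|_| #|_|; clear=> o a b c d; lia.
Qed.

(** No edge enters [O], and [O] has one more vertex in the side than outside it. The uncovered a1
    uses up this surplus, so no matching edge leaves [O]. *)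
Lemma near_not_exceptional F mu Z u : near_perfect F mu -> Ecut F Z ->
  u \in side F -> exceptional F Z u (mu u) -> False.
Proof.
move=> nmu EZ Au [O [a1O a2O dO dO3 [Ou Ov _ _]]].
have [b1Z b2Z _ _ _] := and5P EZ.
have b1O : b1 F \notin O by rewrite (disjointFl dO).
have b2O : b2 F \notin O by rewrite (disjointFl dO).
have [iO card] : ins F O = 0 /\ #|O :&: side F| = #|O :\: side F| + 1.
  by apply: tight_a; rewrite ?dO3.
have := near_flow O nmu; have := inflow_le O (near_pairing nmu).
have : 0 < #|[set x in O :&: side F | mu x \notin O]|.
  by apply/card_gt0P; exists u; rewrite !inE Ou Au.
rewrite iO card a1O (negPf b1O) /=.
by move: #|_| #|_| #|_|; clear=> a b c; lia.
Qed.

(* How an edge can be blocked from above a maximal 3-edge cut Z; the blocked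
   edges below a minimal one are obtained by exchanging the two sides. *)
Definition top_blocked F Z u v := exists D : {set G},
  [/\ witness F D u v, (a1 F \in D) != (a2 F \in D) &
   [/\ b1 F \in D, b2 F \in D & 0 < #|leaving F D|]
   \/ [/\ (b1 F \in D) != (b2 F \in D), u \notin Z & v \notin Z]].

(** Together with [exceptional_inj] this leaves at most one blocked edge at the upper end. The
    exceptional set contains a2, because no matching edge is exceptional for the uncovered a1. *)
Lemma top_exceptional F Z mu u : Ecut F Z ->
  (forall X, Ecut F X -> X \subset Z) -> ~~ trapped F Z -> near_perfect F mu ->
  u \in side F -> mu u != u ->
  top_blocked F Z u (mu u) -> exceptional (swap_a F) Z u (mu u).
Proof.
move=> EZ maxZ ntrap nmu Au mu_u [D [wD one_a]].
have [inv madj flip] := near_pairing nmu.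
have Bv : mu u \notin side F by rewrite flip // Au.
have uv := madj _ mu_u.
have [Du Dv _ _] := and4P wD.
have EZ' : Ecut (swap_a F) Z by rewrite Ecut_swap_a.
have [b1Z b2Z a1Z a2Z _] := and5P EZ.
have uvZ : unsep F u (mu u).
  by apply/unsepP => X EX; rewrite (near_Ecut nmu).
have sepZ : u \in Z = (mu u \in Z) by exact: (unsepP _ _ _ uvZ).
have [_ d4 _] := witness_count wD; have nw := near_witness nmu Au wD.
case=> [[b1D b2D lD]|[one_b Zu Zv]].
  have i1o2 : ins F D = 1 /\ out F D = 2.
    have [] := witness_ins_out wD; rewrite /sum_a /sum_b ?b1D ?b2D //.
      by move: one_a; do 2!case: (_ \in D).
    by move: one_a => + -> +; do 2!case: (_ \in D); rewrite //=; clear; lia.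
  have a1D : a1 F \in D.
    by move: nw; rewrite b1D i1o2.2; case: (a1 F \in D) => //; move: lD; clear; lia.
  have a2D : a2 F \notin D by rewrite a1D in one_a; case: (a2 F \in D) one_a.
  (* If [Z] were inside [D], then by maximality of [Z] a forced edge leaving [D] would be the single
     edge leaving [Z], and [D] would trap [Z]. *)
  have [|/set0Pn[y Ry]] := boolP (Z :\: D == set0).
    rewrite setD_eq0 => sZD; case/negP: ntrap; apply/existsP; exists D.
    apply/existsP; exists u; apply/existsP; exists (mu u).
    rewrite sZD a1D a2D b1D b2D wD uvZ Au Bv uv /=.
    apply/forall_inP => p; rewrite inE => /andP[Zp Ap].
    apply/forall_inP => q; rewrite !inE => /andP[Bq Zq]; apply/implyP => pq.
    case/card_gt0P: lD => -[x y]; rewrite inE /= => /and3P[].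
    case/and4P=> Ax By xy /existsP[X /and3P[EX Xx Xy]] Dx Dy.
    have [_ oZ _] := Ecut_count EZ.
    have Zy : y \notin Z by apply: contra Dy; apply: (subsetP sZD).
    have [] := @ec_le1_inj _ (Z :&: side F) (~: Z :\: side F) p q x y.
    - by rewrite -/(out F Z) oZ.
    - by rewrite inE Zp.
    - by rewrite !inE Bq.
    - by [].
    - by rewrite inE Ax (subsetP (maxZ _ EX)).
    - by rewrite !inE By.
    - by [].
    by move=> _ ->.
  have Zv : mu u \notin Z.
    by apply: (@block12_outside _ (swap_a F) D Z u (mu u) y);
      rewrite ?unsep_swap_a.
  by apply: (@cross_exceptional _ (swap_a F) D Z u (mu u) (b1 F) y);
    rewrite ?in_setI ?b1D ?sepZ //; exact: i1o2.1.
have i1o1 : ins F D = 1.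
  have [] := witness_ins_out wD; rewrite /sum_a /sum_b //.
    by move: one_a; do 2!case: (_ \in D).
  by move: one_b; do 2!case: (_ \in D).
have [x [y [Ix Ry]]] : exists x y, x \in D :&: Z /\ y \in Z :\: D.
  case: (boolP (b1 F \in D)) one_b => [b1D b2D|b1D b2D].
    exists (b1 F), (b2 F); rewrite !inE b1D b1Z b2Z andbT; split=> //.
    by case: (b2 F \in D) b2D.
  by exists (b2 F), (b1 F); rewrite !inE b1D b1Z b2Z andbT; case: (b2 F \in D) b2D.
case: (boolP (a1 F \in D)) one_a => [a1D a2D|a1D a2D].
  by apply: (@cross_exceptional _ (swap_a F) D Z u (mu u) x y) => //.
have {}a2D : a2 F \in D by case: (a2 F \in D) a2D.
exfalso; apply: (near_not_exceptional nmu EZ Au).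
exact: (@cross_exceptional _ F D Z u (mu u) x y).
Qed.

Lemma top_unique F Z mu u u' : Ecut F Z ->
  (forall X, Ecut F X -> X \subset Z) -> ~~ trapped F Z -> near_perfect F mu ->
  u \in side F -> mu u != u -> u' \in side F -> mu u' != u' ->
  top_blocked F Z u (mu u) -> top_blocked F Z u' (mu u') -> u = u'.
Proof.
move=> EZ maxZ ntrap nmu Au mu_u Au' mu_u' tu tu'.
have [inv madj flip] := near_pairing nmu.
have xu := top_exceptional EZ maxZ ntrap nmu Au mu_u tu.
have xu' := top_exceptional EZ maxZ ntrap nmu Au' mu_u' tu'.
have [] := exceptional_inj _ _ _ _ _ xu xu'; rewrite ?Ecut_swap_a ?madj //=.
  by rewrite flip // Au.
by rewrite flip // Au'.
Qed.

End Pairings.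

(** * Matchings built along a chain of sets *)

Section Layers.
Variable G : sgraph.
Implicit Types (F : frame G) (X Y Z D K S : {set G}) (mu : G -> G).

Lemma hall_pairing F (r : rel G) X Y : subrel r (@adj G) ->
  X \subset side F -> [disjoint Y & side F] -> #|X| = #|Y| ->
  (forall S, S \subset X -> #|S| <= #|neighbours r Y S|) ->
  exists mu, [/\ pairing F mu, forall x, (mu x != x) = (x \in X :|: Y) &
    forall x, x \in X -> r x (mu x)].
Proof.
move=> sub_r sXA dYA cardXY /hall[phi [inj phiP]].
have XA x : x \in X -> x \in side F by move/(subsetP sXA).
have YA y : y \in Y -> y \notin side F by move=> Yy; rewrite (disjointFr dYA).
have YX y : y \in Y -> y \notin X by move=> /YA; apply: contra => /XA.
have imY : [set phi x | x in X] = Y.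
  apply/eqP; rewrite eqEcard card_in_imset // cardXY leqnn andbT.
  by apply/subsetP => y /imsetP[x Xx ->]; case: (phiP x Xx).
pose psi y := odflt y [pick x in X | phi x == y].
have phiK x : x \in X -> psi (phi x) = x.
  move=> Xx; rewrite /psi; case: pickP => [z /andP[Xz /eqP/inj->]|/(_ x)] //.
  by rewrite Xx eqxx.
have psiP y : y \in Y -> psi y \in X /\ phi (psi y) = y.
  by rewrite -imY => /imsetP[x Xx ->]; rewrite phiK.
pose mu x := if x \in X then phi x else if x \in Y then psi x else x.
have muX x : x \in X -> mu x = phi x by rewrite /mu => ->.
have muY y : y \in Y -> mu y = psi y.
  by move=> Yy; rewrite /mu Yy (negPf (YX _ Yy)).
have muN x : x \notin X -> x \notin Y -> mu x = x.
  by rewrite /mu => /negPf-> /negPf->.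
have moved x : (mu x != x) = (x \in X :|: Y).
  rewrite inE; case: (boolP (x \in X)) => [Xx|nX].
    have [Yx _] := phiP x Xx; rewrite muX //.
    by apply: contraTneq Xx => <-; apply: YX.
  case: (boolP (x \in Y)) => [Yx|nY]; last by rewrite muN ?eqxx.
  by rewrite muY //; apply: contraNneq nX => <-; case: (psiP x Yx).
exists mu; split=> //; last by move=> x Xx; rewrite muX //; case: (phiP x Xx).
split=> [x|x|x].
- case: (boolP (x \in X)) => [Xx|nX].
    by rewrite (muX x Xx) muY ?phiK //; case: (phiP x Xx).
  case: (boolP (x \in Y)) => [Yx|nY]; last by rewrite !muN.
  by have [Xp phip] := psiP x Yx; rewrite (muY x Yx) muX.
- rewrite moved inE => /orP[Xx|Yx].
    by rewrite muX //; case: (phiP x Xx) => _ /sub_r.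
  have [Xp phip] := psiP x Yx; rewrite muY // adj_sym -{2}phip.
  by case: (phiP _ Xp) => _ /sub_r.
rewrite moved inE => /orP[Xx|Yx].
  have [Yx _] := phiP x Xx.
  by rewrite muX // (XA x) // (negPf (YA _ Yx)).
by have [Xp _] := psiP x Yx; rewrite muY // (YA x) // XA.
Qed.

Lemma moved_stable F mu X : pairing F mu -> (forall x, (mu x != x) = (x \in X)) ->
  forall x, (mu x \in X) = (x \in X).
Proof. by case=> inv _ _ moved x; rewrite -!moved inv eq_sym. Qed.

(** Induction on the size of [X]: let [Y] be the largest member below [X], and join the matching
    already built inside [Y] to one of the layer between [Y] and [X]. [K] holds the vertices to be
    left uncovered. *)
Lemma chain_pairing F (C : {set {set G}}) K :
  {in C &, forall X Y, X \subset Y \/ Y \subset X} ->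
  (forall X Y, X \in set0 |: C -> Y \in setT |: C -> X \subset Y ->
     exists mu, pairing F mu /\ forall x, (mu x != x) = (x \in Y :\: X :\: K)) ->
  exists mu, [/\ pairing F mu, forall x, (mu x == x) = (x \in K) &
    forall Z x, Z \in C -> (mu x \in Z) = (x \in Z)].
Proof.
move=> nested layer.
suff build n X : #|X| < n -> X \in setT |: C -> exists mu,
    [/\ pairing F mu, forall x, (mu x != x) = (x \in X :\: K) &
      forall Z x, Z \in C -> (mu x \in Z) = (x \in Z)].
  have [mu [pmu moved stab]] := build _ setT (ltnSn _) (setU11 _ _).
  exists mu; split=> // x; have := moved x; rewrite !inE andbT.
  by move/negb_inj.
elim: n X => // n IHn X leXn CX.
have [X0|X0] := eqVneq X set0.
  exists id; split=> // [|x]; first by split=> // x; rewrite eqxx.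
  by rewrite eqxx X0 !inE andbF.
pose P Y := (Y \in set0 |: C) && (Y \proper X).
have P0 : P set0 by rewrite /P setU11 proper0.
case: (@arg_maxnP _ set0 P (fun Y => #|Y|) P0) => Y /andP[CY ltYX] maxY.
have sYX := proper_sub ltYX.
have [mu1 [pmu1 moved1 stab1]] : exists mu,
    [/\ pairing F mu, forall x, (mu x != x) = (x \in Y :\: K) &
      forall Z x, Z \in C -> (mu x \in Z) = (x \in Z)].
  move: CY; rewrite in_setU1 => /orP[/eqP->|CY].
    exists id; split=> // [|x]; first by split=> // x; rewrite eqxx.
    by rewrite eqxx !inE andbF.
  by apply: IHn; [have := proper_card ltYX; lia | rewrite in_setU1 CY orbT].
have [mu2 [pmu2 moved2]] := layer Y X CY CX sYX.
have [inv1 adj1 flip1] := pmu1; have [inv2 adj2 flip2] := pmu2.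
have stabY1 x : (mu1 x \in Y) = (x \in Y).
  have [m1|] := boolP (mu1 x != x); last by rewrite negbK => /eqP->.
  have := m1; rewrite moved1 inE => /andP[_ ->].
  by move: m1; rewrite moved1 -(moved_stable pmu1 moved1) inE => /andP[].
have stab2 Z x : (Z \subset Y \/ X \subset Z) -> (mu2 x \in Z) = (x \in Z).
  move=> sub; have [m2|] := boolP (mu2 x != x); last by rewrite negbK => /eqP->.
  have M2 := m2; rewrite moved2 in M2; have M2' := M2.
  rewrite -(moved_stable pmu2 moved2) in M2'.
  move: M2 M2'; rewrite !inE => /and3P[_ Yx Xx] /and3P[_ Ym Xm].
  case: sub => /subsetP sub; last by rewrite !sub.
  by apply/idP/idP => /sub; rewrite ?(negPf Yx) ?(negPf Ym).
have stabY2 x : (mu2 x \in Y) = (x \in Y) by apply: stab2 => //; left.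
exists (fun x => if x \in Y then mu1 x else mu2 x); split=> [|x|Z x CZ].
- split=> x; case: (boolP (x \in Y)) => Yx; rewrite ?stabY1 ?stabY2.
  + by rewrite Yx inv1.
  + by rewrite (negPf Yx) inv2.
  + exact: adj1.
  + exact: adj2.
  + exact: flip1.
  + exact: flip2.
- case: ifPn => Yx; first by rewrite moved1 !inE Yx (subsetP sYX).
  by rewrite moved2 !inE Yx.
case: ifPn => Yx; first exact: stab1.
apply: stab2 => //.
have [sXZ|nXZ] := boolP (X \subset Z); first by right.
have ltZX : Z \proper X.
  rewrite properE nXZ andbT.
  move: CX; rewrite in_setU1 => /orP[/eqP->|CX]; first exact: subsetT.
  by case: (nested _ _ CX CZ) => // s; rewrite s in nXZ.
left; have := maxY Z; rewrite /P in_setU1 CZ orbT ltZX => /(_ isT) /= leZY.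
move: CY; rewrite in_setU1 => /orP[/eqP Y0|CY].
  by move: leZY; rewrite Y0 cards0 leqn0 cards_eq0 => /eqP->.
case: (nested _ _ CY CZ) => // sYZ.
by rewrite (_ : Z = Y) //; apply/eqP; rewrite eq_sym eqEcard sYZ.
Qed.

(** Edges from [S] that stay within [Y] end in [X], in [K] or among the neighbours added to the set,
    so every edge leaving the set leaves [X] or [Y] as well. It is applied to a violator [S] of
    Hall's condition in the layer. *)
Lemma out_layer F K X Y S : X \subset Y ->
  S \subset (Y :\: X) :&: side F :\: K ->
  out F (X :|: (K :\: side F) :|: S
         :|: neighbours (@adj G) (Y :\: X :\: side F :\: K) S)
  <= out F X + out F Y.
Proof.
move=> sXY sS; set T := neighbours _ _ _; rewrite /out /ec.
apply: leq_trans (leq_card_setU _ _); apply/subset_leq_card/subsetP => -[x y].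
rewrite !inE /= => /and3P[/andP[Wx Ax] /andP[By Wy] xy].
move: Wy; rewrite !negb_or By /= => /andP[/andP[/andP[Xy Ky] Sy]].
rewrite Ky Xy /= => Ty.
rewrite Ax xy !andbT; case: (boolP (x \in X)) Wx => //= _.
rewrite Ax /= andbF orbF => Sx.
have := subsetP sS _ Sx; rewrite !inE => /and3P[_ /andP[_ ->] _] /=.
apply: contra Ty => ->; rewrite /=.
by apply/existsP; exists x; rewrite Sx.
Qed.

Lemma out_set0 F : out F set0 = 0.
Proof.
apply/eqP; rewrite -leqn0 leqNgt; apply/negP => /ec_gt0P[x [y []]].
by rewrite !inE.
Qed.

Lemma out_setT F : out F setT = 0.
Proof.
apply/eqP; rewrite -leqn0 leqNgt; apply/negP => /ec_gt0P[x [y [_]]].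
by rewrite !inE andbF.
Qed.

Section Layer.
Variables (F : frame G) (K X Y S : {set G}).
Let A1 := (Y :\: X) :&: side F :\: K.
Let B1 := Y :\: X :\: side F :\: K.
Let T := neighbours (@adj G) B1 S.
Let W := X :|: (K :\: side F) :|: S :|: T.
Hypothesis sS : S \subset A1.

Lemma layer_in_side : W :&: side F = (X :&: side F) :|: S /\
  #|W :&: side F| = #|X :&: side F| + #|S|.
Proof.
have SA x : x \in S -> (x \in side F) /\ (x \notin X).
  by move/(subsetP sS); rewrite !inE => /and3P[_ /andP[-> _] ->].
have eW : W :&: side F = (X :&: side F) :|: S.
  apply/setP => x; rewrite !inE; have := SA x.
  case: (x \in S) => [/(_ isT)[-> _]|_]; rewrite ?orbT ?orbF //.
  by case: (x \in side F); rewrite /= ?andbF ?orbF ?andbT //.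
split=> //; rewrite eW -cardsUI; set I := _ :&: S.
have -> : I = set0.
  apply/setP => x; rewrite !inE; apply/negP => /andP[/andP[Xx _]] /SA[_].
  by rewrite Xx.
by rewrite cards0 addn0.
Qed.

Lemma layer_coside : #|W :\: side F| = #|(X :|: K) :\: side F| + #|T|.
Proof.
have eW : W :\: side F = ((X :|: K) :\: side F) :|: T.
  apply/setP => x; rewrite !inE.
  have := subsetP sS x; rewrite !inE; case: (x \in S) => [/(_ isT)/and3P[_ _ ->]|_].
    by rewrite /= ?andbF /= ?andbF ?orbF.
  by case: (x \in side F); rewrite /= ?andbF ?orbF ?andbT.
rewrite eW -cardsUI; set I := _ :&: T.
have -> : I = set0.
  apply/setP => x; rewrite !inE; apply/negP.
  by case/and3P=> /andP[_ /orP[]Xx] /and4P[Kx _ Xx' _]; rewrite ?Xx in Kx Xx'.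
by rewrite cards0 addn0.
Qed.

Lemma layer_card : X \subset Y ->
  #|A1| + #|X :&: side F| + #|K :&: side F :&: (Y :\: X)| = #|Y :&: side F|.
Proof.
move=> sXY; rewrite -(cardsID X (Y :&: side F)) -(cardsID K (_ :\: X)).
have -> : Y :&: side F :&: X = X :&: side F by rewrite setIAC (setIidPr sXY).
have -> : Y :&: side F :\: X :\: K = A1 by rewrite -setIDAC.
have -> : (Y :&: side F :\: X) :&: K = K :&: side F :&: (Y :\: X).
  by apply/setP => x; rewrite !inE; do !case: (x \in _).
by clear; lia.
Qed.

Lemma layer_cocard : X \subset Y ->
  #|B1| + #|X :\: side F| + #|(K :\: side F) :&: (Y :\: X)| = #|Y :\: side F|.
Proof.
move=> sXY; rewrite -(cardsID X (Y :\: side F)) -(cardsID K (_ :\: X)).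
have -> : (Y :\: side F) :&: X = X :\: side F by rewrite setIDAC (setIidPr sXY).
have -> : Y :\: side F :\: X :\: K = B1.
  by congr (_ :\: _); rewrite !setDDl setUC.
have -> : (Y :\: side F :\: X) :&: K = (K :\: side F) :&: (Y :\: X).
  by apply/setP => x; rewrite !inE; do !case: (x \in _).
by clear; lia.
Qed.

End Layer.

(** A violator of Hall's condition, enlarged as in [out_layer], would give a set separating b1 from
    a1 whose cut has only two edges. *)
Lemma near_layer F X Y :
  X \in set0 |: [set Z | Ecut F Z] -> Y \in setT |: [set Z | Ecut F Z] ->
  X \subset Y -> exists mu, pairing F mu /\
    forall x, (mu x != x) = (x \in Y :\: X :\: [set a1 F; b1 F]).
Proof.
set K := [set a1 F; b1 F] => CX CY sXY.
have a1A := a1_side F; have := b1_side F; rewrite inE => b1A.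
have KA : K :&: side F = [set a1 F].
  apply/setP => x; rewrite !inE; case: eqVneq => [->|_]; first by rewrite a1A.
  by case: eqVneq => [->|_] //; rewrite (negPf b1A).
have KB : K :\: side F = [set b1 F].
  apply/setP => x; rewrite !inE; case: (eqVneq x (a1 F)) => [->|_].
    by rewrite a1A /=; apply/esym; apply: contraNF b1A => /eqP <-.
  by case: eqVneq => [->|_] //=; rewrite ?b1A ?andbF.
have bal Z : Z \in set0 |: (setT |: [set Z | Ecut F Z]) ->
    #|Z :\: side F| + (a1 F \in Z) = #|Z :&: side F| + (b1 F \in Z).
  rewrite !in_setU1 inE => /or3P[/eqP->|/eqP->|EZ].
  - by rewrite set0D set0I !inE.
  - by rewrite setTD setTI !inE card_side.
  have [_ _ ->] := Ecut_count EZ.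
  by case/and5P: EZ => -> _ /negPf-> _ _; rewrite addn0.
have balX : #|X :\: side F| + (a1 F \in X) = #|X :&: side F| + (b1 F \in X).
  by apply: bal; move: CX; rewrite !in_setU1 => /orP[]->; rewrite ?orbT.
have balY : #|Y :\: side F| + (a1 F \in Y) = #|Y :&: side F| + (b1 F \in Y).
  by apply: bal; rewrite in_setU1 CY orbT.
pose A1 := (Y :\: X) :&: side F :\: K; pose B1 := Y :\: X :\: side F :\: K.
have cardI1 (x : G) Z : #|[set x] :&: Z| = (x \in Z).
  have -> : [set x] :&: Z = if x \in Z then [set x] else set0.
    by apply/setP => z; rewrite !inE; case: eqVneq => [->|]; case: ifP;
      rewrite !inE ?eqxx //= => _ /negPf->.
  by case: ifP; rewrite ?cards1 ?cards0.
have mem_sub x : (x \in Y :\: X) + (x \in X) = (x \in Y) :> nat.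
  by have := subsetP sXY x; rewrite !inE; case: (x \in X) => [->|] //; rewrite addn0.
have sA1 : A1 \subset side F by apply/subsetP => x; rewrite !inE => /and3P[].
have dB1 : [disjoint B1 & side F].
  by rewrite disjoints_subset; apply/subsetP => x; rewrite !inE => /and3P[].
have cardAB : #|A1| = #|B1|.
  have := layer_card F K sXY; have := layer_cocard F K sXY.
  rewrite KA KB !cardI1 -/A1 -/B1; have := mem_sub (a1 F); have := mem_sub (b1 F).
  move: balX balY; clear.
  move: #|_| #|_| #|_| #|_| #|_| #|_| (nat_of_bool _) (nat_of_bool _)
    (nat_of_bool _) (nat_of_bool _) (nat_of_bool _) (nat_of_bool _); clear.
  by lia.
have hallAB S : S \subset A1 -> #|S| <= #|neighbours (@adj G) B1 S|.
  move=> sS; set T := neighbours _ _ _; rewrite leqNgt; apply/negP => ltTS.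
  set W := X :|: (K :\: side F) :|: S :|: T.
  have [eWA cA] := layer_in_side sS; have cB := layer_coside sS.
  have oW := out_layer sXY sS.
  rewrite -/A1 -/B1 -/T -/W in eWA cA cB oW.
  have b1W : b1 F \in W by rewrite !inE eqxx b1A !orbT.
  have a1X : a1 F \notin X.
    by move: CX; rewrite in_setU1 inE => /orP[/eqP->|/and5P[]//]; rewrite inE.
  have a1W : a1 F \notin W.
    have : a1 F \notin W :&: side F.
      rewrite eWA !inE (negPf a1X) /=; apply/negP => /(subsetP sS).
      by rewrite !inE eqxx.
    by rewrite inE a1A andbT.
  have := cut_ge3 F b1W a1W.
  have := cutE F W; have := frame_count F W; rewrite /sum_a /sum_b cA cB.
  rewrite b1W (negPf a1W).
  have cXK : #|(X :|: K) :\: side F| = #|X :&: side F| + 1.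
    rewrite setDUl KB.
    move: CX; rewrite in_setU1 inE => /orP[/eqP->|EX].
      by rewrite set0D set0I set0U cards0 cards1.
    have [_ _ <-] := Ecut_count EX; congr #|pred_of_set _|.
    apply/setUidPl; rewrite sub1set inE b1A.
    by case/and5P: EX.
  have a2WY : a2 F \in W -> a2 F \in Y.
    have := a2_side F => a2A Wa2; have : a2 F \in W :&: side F by rewrite inE Wa2.
    rewrite eWA => /setUP[/setIP[/(subsetP sXY)]//|/(subsetP sS)].
    by rewrite !inE => /and3P[_ /andP[]].
  have XW x : x \in X -> x \in W by rewrite !inE => ->.
  rewrite cXK.
  (* A non-empty [X] has one leaving edge, which is paid for by b2 in [W]. A proper [Y] has one
     leaving edge, but then a2 is not in [W]. *)
  have : out F W + (a2 F \in W) <= 1 + (b2 F \in W).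
    have yY : out F Y + (a2 F \in W) <= 1.
      move: CY; rewrite in_setU1 inE => /orP[/eqP->|EY].
        by rewrite out_setT; case: (_ \in W).
      have [_ -> _] := Ecut_count EY.
      by case: (boolP (a2 F \in W)) => // /a2WY; case/and5P: EY => _ _ _ /negPf->.
    have xX : out F X <= (b2 F \in W).
      move: CX; rewrite in_setU1 inE => /orP[/eqP->|EX]; first by rewrite out_set0.
      have [_ -> _] := Ecut_count EX.
      by rewrite XW //; case/and5P: EX.
    by move: oW yY xX; clear; lia.
  move: ltTS; clear.
  move: (ins _ _) (out _ _) (cut _) #|_| #|_| #|_|; clear.
  move=> i o d s t x; case: (a2 F \in W); case: (b2 F \in W); rewrite //=; clear; lia.
have [mu [pmu moved _]] := hall_pairing (fun _ _ => id) sA1 dB1 cardAB hallAB.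
exists mu; split=> // x; rewrite moved !inE.
by case: (x \in side F); rewrite ?andbT ?andbF ?orbF.
Qed.

Lemma near_perfect_exists F : exists mu, near_perfect F mu.
Proof.
have nested : {in [set Z | Ecut F Z] &, forall X Y, X \subset Y \/ Y \subset X}.
  by move=> X Y; rewrite !inE; exact: Ecut_nested.
have [mu [pmu fixed avoid]] := chain_pairing nested (@near_layer F).
exists mu; split=> // [x|Z x EZ]; first by rewrite fixed !inE.
by rewrite avoid // inE.
Qed.

End Layers.

(** * Certificates in the absence of separating 3-edge cuts *)

Section Separations.
Variable G : sgraph.
Implicit Types (F : frame G) (X Y Z D K S : {set G}) (mu : G -> G).

(* Without separating 3-edge cuts, the edges that are not removable are, up to
   exchanging b1 and b2, those in the cuts of these sets. *)
Definition sep11 F D :=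
  [&& a1 F \in D, b1 F \in D, a2 F \notin D, b2 F \notin D & cut D == 4].

Lemma sep11_count F D : sep11 F D ->
  [/\ ins F D = 1, out F D = 1 & #|D :\: side F| = #|D :&: side F|].
Proof.
case/and5P=> a1D b1D a2D b2D /eqP d4.
have := cutE F D; have := frame_count F D; rewrite /sum_a /sum_b d4.
rewrite a1D b1D (negPf a2D) (negPf b2D) /=.
by move: (ins _ _) (out _ _) #|_| #|_|; clear; split; lia.
Qed.

(** If neither contained the other, a1 a2 and b1 b2 would both run from the intersection to the
    outside of the union, and [cut_diff] would give 3 + 3 + 4 <= 4 + 4. *)
Lemma sep11_nested F X Y : sep11 F X -> sep11 F Y ->
  X \subset Y \/ Y \subset X.
Proof.
case/and5P=> a1X b1X a2X b2X /eqP dX /and5P[a1Y b1Y a2Y b2Y /eqP dY].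
have [|/set0Pn[x Xx]] := boolP (X :\: Y == set0).
  by rewrite setD_eq0; left.
have [|/set0Pn[y Yy]] := boolP (Y :\: X == set0).
  by rewrite setD_eq0; right.
have : 3 <= cut (X :\: Y).
  by apply: (@cut_ge3 _ F _ x (b1 F)); rewrite // inE b1Y.
have : 3 <= cut (Y :\: X).
  by apply: (@cut_ge3 _ F _ y (b1 F)); rewrite // inE b1X.
have : 1 < ec (X :&: Y) (~: (X :|: Y)).
  apply: (@ec_gt1 _ _ _ (a1 F) (a2 F) (b1 F) (b2 F));
    rewrite ?inE ?negb_or ?a1X ?a2X ?b1X ?b2X ?adj_a ?adj_b //.
  apply: contraTneq (a1_side F) => -[-> _].
  by have := b1_side F; rewrite inE.
by have := cut_diff X Y; rewrite dX dY; clear; lia.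
Qed.

Lemma sep11_layer F X Y :
  X \in set0 |: [set Z | sep11 F Z] -> Y \in setT |: [set Z | sep11 F Z] ->
  X \subset Y -> exists mu, pairing F mu /\
    forall x, (mu x != x) = (x \in Y :\: X :\: set0).
Proof.
move=> CX CY sXY.
have bal Z : Z \in set0 |: (setT |: [set Z | sep11 F Z]) ->
    #|Z :\: side F| = #|Z :&: side F|.
  rewrite !in_setU1 inE => /or3P[/eqP->|/eqP->|EZ].
  - by rewrite set0D set0I.
  - by rewrite setTD setTI card_side.
  by have [_ _ ->] := sep11_count EZ.
have balX : #|X :\: side F| = #|X :&: side F|.
  by apply: bal; move: CX; rewrite !in_setU1 => /orP[]->; rewrite ?orbT.
have balY : #|Y :\: side F| = #|Y :&: side F|.
  by apply: bal; rewrite in_setU1 CY orbT.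
pose A1 := (Y :\: X) :&: side F :\: set0; pose B1 := Y :\: X :\: side F :\: set0.
have sA1 : A1 \subset side F by apply/subsetP => x; rewrite !inE /= => /andP[].
have dB1 : [disjoint B1 & side F].
  by rewrite disjoints_subset; apply/subsetP => x; rewrite !inE /= => /andP[].
have cardAB : #|A1| = #|B1|.
  have := layer_card F set0 sXY; have := layer_cocard F set0 sXY.
  rewrite set0D !set0I cards0 -/A1 -/B1 balX balY.
  by move: #|_| #|_| #|_| #|_|; clear; lia.
have hallAB S : S \subset A1 -> #|S| <= #|neighbours (@adj G) B1 S|.
  move=> sS; set T := neighbours _ _ _; rewrite leqNgt; apply/negP => ltTS.
  set W := X :|: (set0 :\: side F) :|: S :|: T.
  have [eWA cA] := layer_in_side sS; have cB := layer_coside sS.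
  have oW := out_layer sXY sS.
  rewrite -/A1 -/B1 -/T -/W setU0 balX in eWA cA cB oW.
  have := frame_count F W; rewrite /sum_a /sum_b cA cB.
  have a2WY : a2 F \in W -> a2 F \in Y.
    have := a2_side F => a2A Wa2; have : a2 F \in W :&: side F by rewrite inE Wa2.
    rewrite eWA => /setUP[/setIP[/(subsetP sXY)]//|/(subsetP sS)].
    by rewrite !inE /= => /andP[/andP[]].
  have XW x : x \in X -> x \in W by rewrite !inE => ->.
  have yY : out F Y + (a2 F \in W) <= 1.
    move: CY; rewrite in_setU1 inE => /orP[/eqP->|EY].
      by rewrite out_setT; case: (_ \in W).
    have [_ -> _] := sep11_count EY.
    by case: (boolP (a2 F \in W)) => // /a2WY; case/and5P: EY => _ _ /negPf->.
  have xX : out F X <= (b1 F \in W).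
    move: CX; rewrite in_setU1 inE => /orP[/eqP->|EX]; first by rewrite out_set0.
    have [_ -> _] := sep11_count EX.
    by rewrite XW //; case/and5P: EX.
  (* Once the class sizes are cancelled, the violated Hall condition puts at least 3 plus the term
     of b1 on one side of the balance, while the bounds allow at most 2 plus this term on the
     other. *)
  move: ltTS oW xX yY; clear.
  move: (ins _ _) (out _ _) (out _ _) (out _ _) #|_| #|_| #|_|; clear.
  move: (_ \in _) (_ \in _) (_ \in _) (_ \in _).
  by do 4!case; rewrite //=; clear; lia.
have [mu [pmu moved _]] := hall_pairing (fun _ _ => id) sA1 dB1 cardAB hallAB.
exists mu; split=> // x; rewrite moved !inE.
by case: (x \in side F); rewrite ?andbT ?andbF ?orbF.
Qed.

Lemma sep11_pairing F : exists mu, [/\ pairing F mu, forall x, mu x != x &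
  forall D x, sep11 F D -> (mu x \in D) = (x \in D)].
Proof.
have nested : {in [set Z | sep11 F Z] &, forall X Y, X \subset Y \/ Y \subset X}.
  by move=> X Y; rewrite !inE; exact: sep11_nested.
have [mu [pmu fixed avoid]] := chain_pairing nested (@sep11_layer F).
exists mu; split=> // [x|D x sD]; first by rewrite fixed inE.
by rewrite avoid // inE.
Qed.

(** The edges a1 a2 and b1 b2 are defects in the two uncrossing identities, so each pair of cuts has
    at most 6 edges in total. *)
Lemma sep11_cross F D X : sep11 F D -> sep11 (swap_b F) X ->
  [/\ cut (D :&: X) = 3, cut (D :|: X) = 3, cut (D :\: X) = 3 &
      cut (X :\: D) = 3].
Proof.
case/and5P=> a1D b1D a2D b2D /eqP dD /and5P /= [a1X b2X a2X b1X /eqP dX].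
have := cut_cap_cup D X; have := cut_diff D X; rewrite dD dX.
have : 0 < ec (D :\: X) (X :\: D).
  by apply: (@ec_gt0 _ _ _ (b1 F) (b2 F)); rewrite ?inE ?adj_b ?b1D ?b2D ?b1X.
have : 0 < ec (D :&: X) (~: (D :|: X)).
  by apply: (@ec_gt0 _ _ _ (a1 F) (a2 F)); rewrite ?inE ?adj_a ?negb_or ?a1D ?a2D.
have : 3 <= cut (D :&: X).
  by apply: (@cut_ge3 _ F _ (a1 F) (a2 F)); rewrite inE ?a1D // (negPf a2D).
have : 3 <= cut (D :|: X).
  by apply: (@cut_ge3 _ F _ (a1 F) (a2 F)); rewrite inE ?negb_or ?a1D ?a2D.
have : 3 <= cut (D :\: X).
  by apply: (@cut_ge3 _ F _ (b1 F) (b2 F)); rewrite inE ?b1D ?b1X ?b2X.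
have : 3 <= cut (X :\: D).
  by apply: (@cut_ge3 _ F _ (b2 F) (b1 F)); rewrite inE ?b2D ?b2X ?b1D.
by clear; split; lia.
Qed.

(** Nested [X] and [Y] that differ do so inside [D] or outside it. There two sets with cuts of 3
    edges would have a union with a cut of 4 and a non-empty intersection, but 3 + 4 > 3 + 3. *)
Lemma sep11_unique F D X Y : sep11 F D -> sep11 (swap_b F) X ->
  sep11 (swap_b F) Y -> X = Y.
Proof.
move=> sD; wlog sXY : X Y / X \subset Y => [wl sX sY|sX sY].
  by case: (sep11_nested sX sY) => [/wl->|/wl->].
apply/eqP; rewrite eqEsubset sXY /=; apply/subsetP => z Yz.
apply/negPn/negP => Xz.
have [_ cU c2 _] := sep11_cross sD sX; have [c3 _ _ c4] := sep11_cross sD sY.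
have [a1D b1D a2D b2D /eqP dD] := and5P sD.
have [a1X _ a2X _ _] := and5P sX.
have [a1Y _ a2Y _ _] := and5P sY; rewrite /= in a1X a2X a1Y a2Y.
have XY x : x \in X -> x \in Y by apply: (subsetP sXY).
have [Dz|Dz] := boolP (z \in D).
  have := cut_cap_cup (D :\: X) (D :&: Y).
  have -> : (D :\: X) :|: (D :&: Y) = D.
    apply/setP => x; rewrite !inE; have := XY x.
    by case: (x \in D); case: (x \in X) => // ->.
  have : 3 <= cut ((D :\: X) :&: (D :&: Y)).
    by apply: (@cut_ge3 _ F _ z (a2 F)); rewrite !inE ?Dz ?Xz // (negPf a2D) andbF.
  by rewrite c2 c3 dD; clear; lia.
have := cut_cap_cup (~: (D :|: X)) (Y :\: D).
have -> : ~: (D :|: X) :|: (Y :\: D) = ~: D.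
  apply/setP => x; rewrite !inE negb_or; have := XY x.
  by case: (x \in D); case: (x \in X) => // ->.
have : 3 <= cut (~: (D :|: X) :&: (Y :\: D)).
  by apply: (@cut_ge3 _ F _ z (a1 F)); rewrite !inE negb_or ?Dz ?Xz ?a1D.
by rewrite !cutC cU c4 dD; clear; lia.
Qed.

Lemma crossing_le2 F D mu : pairing F mu -> ins F D <= 1 -> out F D <= 1 ->
  #|[set u in side F | (u \in D) != (mu u \in D)]| <= 2.
Proof.
move=> pmu i1 o1.
have inC : ins F (~: D) = out F D by rewrite /ins /out setCK.
have := inflow_le D pmu; have := inflow_le (~: D) pmu; rewrite inC => le1 le2.
apply: leq_trans (leq_add (leq_trans le1 o1) (leq_trans le2 i1)).
apply: leq_trans (leq_card_setU _ _); apply/subset_leq_card/subsetP => u.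
rewrite !inE negbK => /andP[->].
by case: (u \in D); case: (mu u \in D).
Qed.

End Separations.

(** * From deficient sets to certificates *)

Section Dependence.
Variable G : sgraph.
Implicit Types (F : frame G) (X Y Z W D S : {set G}) (u v a b x y : G).

Definition leak F u v X := forall x y, x \in X -> x \in side F ->
  y \notin X -> y \notin side F -> adj x y -> x = u /\ y = v.

Lemma leak_out F u v X : leak F u v X -> out F X <= 1.
Proof.
move=> leakX; rewrite leqNgt; apply/negP => /card_gt1P[[x y] [[x' y']]].
rewrite !inE /= => -[/and3P[/andP[Xx Ax] /andP[By Xy] xy]].
case/and3P=> /andP[Xx' Ax'] /andP[By' Xy'] xy' /eqP[].
have [-> ->] := leakX x y Xx Ax Xy By xy.
by have [-> ->] := leakX x' y' Xx' Ax' Xy' By' xy'.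
Qed.

Lemma leak_out0 F u v X : leak F u v X -> ~~ ((u \in X) && (v \notin X)) ->
  out F X = 0.
Proof.
move=> leakX nuv; apply/eqP; rewrite -leqn0 leqNgt; apply/negP.
case/ec_gt0P=> x [y []]; rewrite !inE => /andP[Xx Ax] /andP[By Xy] xy.
by have [ex ey] := leakX x y Xx Ax Xy By xy; case/negP: nuv; rewrite -ex -ey Xx.
Qed.

Lemma leak_swap F u v X : leak F u v X -> leak (swap_sides F) v u (~: X).
Proof.
move=> leakX x y /=; rewrite !inE !negbK => Xx Bx Xy Ay xy.
by have [] := leakX y x Xy Ay Xx Bx; rewrite 1?adj_sym.
Qed.

Lemma leakI F u v X Y : leak F u v X -> leak F u v Y -> leak F u v (X :&: Y).
Proof.
move=> leakX leakY x y; rewrite !inE => /andP[Xx Yx] Ax.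
rewrite negb_and => /orP[nX|nY] By xy; first exact: leakX.
exact: leakY.
Qed.

Lemma leakU F u v X Y : leak F u v X -> leak F u v Y -> leak F u v (X :|: Y).
Proof.
move=> leakX leakY x y; rewrite !inE negb_or => + Ax /andP[nX nY] By xy.
by case/orP=> [Xx|Yx]; [exact: leakX | exact: leakY].
Qed.

Lemma sum_a_swap F X : sum_a (swap_sides F) (~: X) + sum_b F X = 2.
Proof. by rewrite /sum_a /sum_b !inE /=; do 2!case: (_ \in X). Qed.

Lemma sum_b_swap F X : sum_b (swap_sides F) (~: X) + sum_a F X = 2.
Proof. by rewrite /sum_a /sum_b !inE /=; do 2!case: (_ \in X). Qed.

(* X certifies that a perfect matching avoiding the edges a1 a2 and b1 b2
   and using ab also uses uv. *)
Record implies_edge F u v a b X : Prop := ImpliesEdge {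
  ie_a : a \in side F; ie_b : b \notin side F; ie_adj : adj a b;
  ie_aX : a \notin X; ie_bX : b \in X;
  ie_uX : u \in X; ie_vX : v \notin X;
  ie_leak : leak F u v X;
  ie_card : #|X :\: side F| = #|X :&: side F|;
  ie_cut : cut X = 4;
  ie_ins : ins F X + sum_b F X = 1 + sum_a F X
}.

(* Y certifies the same for the perfect matchings through a1 a2 and b1 b2. *)
Record implies_edge2 F u v a b Y : Prop := ImpliesEdge2 {
  ie2_aY : a \notin Y; ie2_bY : b \in Y;
  ie2_a1 : a1 F \notin Y; ie2_a2 : a2 F \notin Y;
  ie2_b1 : b1 F \in Y; ie2_b2 : b2 F \in Y;
  ie2_leak : leak F u v Y;
  ie2_card : #|Y :\: side F| = #|Y :&: side F| + 2
}.

Lemma card_side_swap F X : #|~: X :&: side (swap_sides F)| = #|~: X :\: side F|.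
Proof. by rewrite /= setDE. Qed.

Lemma card_coside_swap F X : #|~: X :\: side (swap_sides F)| = #|~: X :&: side F|.
Proof. by rewrite /= setDE setCK. Qed.

Lemma implies_edge_swap F u v a b X : implies_edge F u v a b X ->
  implies_edge (swap_sides F) v u b a (~: X).
Proof.
case=> Aa Bb ab aX bX uX vX lX cX d4 iX.
split; rewrite ?inE ?negbK ?cutC ?card_side_swap ?card_coside_swap //.
- by rewrite adj_sym.
- exact: leak_swap.
- by have := card_coside F X; rewrite cX; move: #|_| #|_| #|_|; clear; lia.
have := sum_a_swap F X; have := sum_b_swap F X; rewrite ins_swap.
by move: iX; move: (ins _ _) (sum_a _ _) (sum_a _ _) (sum_b _ _) (sum_b _ _); clear; lia.
Qed.

Lemma implies_edge2_swap F u v a b Y : implies_edge2 F u v a b Y ->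
  implies_edge2 (swap_sides F) v u b a (~: Y).
Proof.
case=> aY bY a1Y a2Y b1Y b2Y lY cY.
split; rewrite ?inE ?negbK ?card_side_swap ?card_coside_swap //.
- exact: leak_swap.
by have := card_coside F Y; rewrite cY; move: #|_| #|_| #|_|; clear; lia.
Qed.

Lemma forced_out F Y : Ecut F Y -> exists p q,
  [/\ forced F p q, p \in Y, q \notin Y & q \notin side F].
Proof.
move=> EY; have [_ oY _] := Ecut_count EY.
have /ec_gt0P[p [q []]] : 0 < out F Y by rewrite oY.
rewrite !inE => /andP[Yp Ap] /andP[Bq Yq] pq; exists p, q; split=> //.
by rewrite /forced Ap Bq pq /=; apply/existsP; exists Y; rewrite EY Yp.
Qed.

(** Adding a1 to [X] removes the entering edge ab. The complement is then a 3-edge cut separating f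
    from e, and its single leaving edge enters [X]. *)
Lemma low_forced_a1 F u v a b X : implies_edge F u v a b X ->
  a = a1 F -> sum_b F X = 0 ->
  exists p q, [/\ forced F p q, p \notin X & q \in X].
Proof.
case=> Aa Bb ab aX bX uX vX lX cX d4 iX ea sb; rewrite {a}ea in Aa ab aX.
have [b1X b2X] : b1 F \notin X /\ b2 F \notin X.
  by move: sb; rewrite /sum_b; do 2!case: (_ \in X).
have [a2X i2] : a2 F \in X /\ ins F X = 2.
  have := cutE F X; have := leak_out lX; move: iX.
  rewrite /sum_a /sum_b d4 (negPf aX) (negPf b1X) (negPf b2X).
  by move: (ins _ _) (out _ _) => i o; case: (a2 F \in X); rewrite /=; clear; split=> //; lia.
pose Z := a1 F |: X.
have ZA : #|Z :&: side F| = #|X :&: side F| + 1.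
  have -> : Z :&: side F = a1 F |: (X :&: side F).
    by apply/setP => x; rewrite !inE; case: eqVneq => [->|]; rewrite ?Aa.
  by rewrite cardsU1 inE (negPf aX) addnC.
have ZB : Z :\: side F = X :\: side F.
  by apply/setP => x; rewrite !inE; case: eqVneq => [->|]; rewrite ?Aa.
have insZ : ins F Z + 1 <= ins F X.
  rewrite /ins ZB addnC (ec_splitl [set a1 F] (~: X :&: side F)); apply: leq_add.
    by apply: (@ec_gt0 _ _ _ (a1 F) b); rewrite // !inE ?eqxx ?aX ?bX ?Bb // Aa.
  apply: ec_sub => //; apply/subsetP => x; rewrite !inE negb_or.
  by case/andP=> /andP[-> ->] ->.
have EY : Ecut F (~: Z).
  have d3 : cut Z <= 3.
    have := cutE F Z; have := frame_count F Z; rewrite /sum_a /sum_b ZA ZB cX.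
    rewrite !inE eqxx a2X (negPf b1X) (negPf b2X) orbT !orbF /=.
    have -> : b1 F == a1 F = false by apply/eqP => e; have := b1_side F; rewrite e inE Aa.
    have -> : b2 F == a1 F = false by apply/eqP => e; have := b2_side F; rewrite e inE Aa.
    rewrite i2 in insZ; move: insZ.
    by move: (ins _ _) (out _ _) (cut _) #|_|; clear; rewrite /=; lia.
  apply: Ecut_le3; rewrite ?cutC // !inE ?negbK ?eqxx ?a2X ?orbT // negb_or ?b1X ?b2X andbT.
    by apply/eqP => e; have := b1_side F; rewrite e inE Aa.
  by apply/eqP => e; have := b2_side F; rewrite e inE Aa.
have [p [q [fpq Zp Zq Bq]]] := forced_out EY; exists p, q; split=> //.
  by move: Zp; rewrite !inE negb_or => /andP[].
by move: Zq; rewrite !inE negbK; case: eqVneq => [eq|//]; rewrite eq Aa in Bq.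
Qed.

Lemma forced_swap_a F p q : forced (swap_a F) p q = forced F p q.
Proof.
rewrite /forced /=; do 3!congr (_ && _).
by apply: eq_existsb => X; rewrite Ecut_swap_a.
Qed.

Lemma forced_swap F p q : forced (swap_sides F) q p = forced F p q.
Proof.
rewrite /forced /= !inE negbK adj_sym !andbA [(q \notin _) && _]andbC.
congr (_ && _); apply/existsP/existsP => -[X /and3P[EX qX pX]]; exists (~: X).
  by rewrite -Ecut_swap setCK EX !inE negbK qX pX.
by rewrite Ecut_swap EX !inE negbK qX pX.
Qed.

Lemma low_forced_adjacent F u v a b X : implies_edge F u v a b X ->
  a \in [:: a1 F; a2 F] -> sum_b F X = 0 ->
  exists p q, [/\ forced F p q, p \notin X & q \in X].
Proof.
move=> ie; rewrite !inE => /orP[] /eqP ea sb.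
  exact: low_forced_a1 ie ea sb.
have ie' : implies_edge (swap_a F) u v a b X.
  have sa : sum_a (swap_a F) X = sum_a F X by rewrite /sum_a addnC.
  by case: ie => *; split; rewrite ?sa.
have [p [q [fpq Xp Xq]]] := low_forced_a1 ie' ea sb; exists p, q; split=> //.
by rewrite -forced_swap_a.
Qed.

(** Uncrossing makes [Y :\: X] a 3-edge cut separating f from e. Its leaving edge cannot leave [Y],
    since only uv may do so and [u] lies in [X]; hence it ends in [X :&: Y]. *)
Lemma low_forced F u v a b X Y :
  implies_edge F u v a b X -> implies_edge2 F u v a b Y -> sum_b F X = 0 ->
  exists p q, [/\ forced F p q, p \notin X, p \in Y, q \in X & q \in Y].
Proof.
case=> Aa Bb ab aX bX uX vX lX cX d4 iX [aY bY a1Y a2Y b1Y b2Y lY cY] sb.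
have [b1X b2X] : b1 F \notin X /\ b2 F \notin X.
  by move: sb; rewrite /sum_b; do 2!case: (_ \in X).
set I := X :&: Y; set U := X :|: Y; set Q := Y :\: X; set W := X :\: Y.
have bI : b \in I by rewrite inE bX.
have aI : a \notin I by rewrite inE (negPf aX).
have bU : b \in U by rewrite inE bX.
have aU : a \notin U by rewrite inE negb_or aX.
have iX' : ins F X = 1 + sum_a F X by rewrite -iX sb addn0.
have s12 : 0 < sum_a F X <= 2.
  have := cutE F X; have := leak_out lX; move: iX'; rewrite d4 /sum_a (negPf b1X) (negPf b2X).
  move: (ins _ _) (out _ _) => i o.
  by case: (a1 F \in X); case: (a2 F \in X); rewrite /=; clear; lia.
have cI : #|I :&: side F| < #|I :\: side F|.
  have := cut_ge3 F bI aI; have := leak_out (leakI lX lY).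
  have := cutE F I; have := frame_count F I; rewrite -/I.
  rewrite /sum_a /sum_b !inE (negPf a1Y) (negPf a2Y) (negPf b1X) (negPf b2X) !andbF /=.
  by move: (ins _ _) (out _ _) (cut _) #|_| #|_|; clear; lia.
have cU : #|U :&: side F| < #|U :\: side F|.
  have := cut_ge3 F bU aU; have := leak_out (leakU lX lY); move: s12.
  have := cutE F U; have := frame_count F U; rewrite -/U.
  rewrite /sum_a /sum_b !inE (negPf a1Y) (negPf a2Y) b1Y b2Y !orbF !orbT.
  move: (ins _ _) (out _ _) (cut _) #|_| #|_|; clear=> i o d c e.
  by case: (a1 F \in X); case: (a2 F \in X); rewrite /=; clear; lia.
have eXA := card_side_split F X Y; have eXB := card_coside_split F X Y.
have eYA := card_side_split F Y X; have eYB := card_coside_split F Y X.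
have eUA := card_side_split F U X; have eUB := card_coside_split F U X.
have UX : U :&: X = X by rewrite /U setUC setIC setKU.
have UQ : U :\: X = Q by rewrite /U setDUl setDv set0U.
rewrite -/I -/W in eXA eXB; rewrite [Y :&: X]setIC -/I -/Q in eYA eYB.
rewrite UX UQ in eUA eUB.
(* Intersection and union each have a surplus of vertices outside the side. These surpluses add up
   to that of [X] and [Y], which is 2, so each is exactly 1. *)
have cards : #|Q :\: side F| = #|Q :&: side F| + 1 /\
             #|W :&: side F| = #|W :\: side F| + 1.
  move: cI cU cX cY eXA eXB eYA eYB eUA eUB.
  move: #|_| #|_| #|_| #|_| #|_| #|_| #|_| #|_| #|_| #|_| #|_| #|_|; clear.
  by split; lia.
have [cQ cW] := cards.
have outQ p q : p \in Q -> p \in side F -> q \notin Q -> q \notin side F ->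
    adj p q -> q \in I.
  rewrite !inE => /andP[Xp Yp] Ap; rewrite negb_and negbK => Qq Bq pq.
  have Yq : q \in Y.
    apply/negPn/negP => Yq; have [eu _] := lY p q Yp Ap Yq Bq pq.
    by rewrite eu uX in Xp.
  by move: Qq; rewrite Yq andbT orbF.
have insW x y : x \notin W -> x \in side F -> y \in W -> y \notin side F ->
    adj x y -> x \notin X /\ x \notin Y.
  rewrite !inE => + Ax /andP[Yy Xy] By xy; rewrite negb_and negbK.
  have Yx : x \notin Y.
    apply/negP => Yx; have [_ ev] := lY x y Yx Ax Yy By xy.
    by rewrite ev (negPf vX) in Xy.
  by rewrite (negPf Yx) /=.
(* The edges leaving [Q], the edges entering [W] and ab are distinct edges entering [X]. *)
have total : out F Q + ins F W + 1 <= ins F X.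
  rewrite /ins (ec_splitl Y (~: X :&: side F)) -addnA; apply: leq_add.
    apply/subset_leq_card/subsetP => -[x y]; rewrite !inE /=.
    case/and3P=> /andP[/andP[Xx Yx] Ax] /andP[By Qy] xy.
    have := outQ x y; rewrite !inE Xx Yx Ax Qy By xy => /(_ isT isT isT isT isT).
    by case/andP=> ->.
  rewrite addnC (ec_splitr Y (_ :\: Y)); apply: leq_add.
    by apply: (@ec_gt0 _ _ _ a b); rewrite // !inE ?aX ?aY ?Aa // bX bY Bb.
  apply/subset_leq_card/subsetP => -[x y]; rewrite !inE /=.
  case/and3P=> /andP[Wx Ax] /andP[By /andP[Yy Xy]] xy.
  have := insW x y; rewrite !inE Wx Ax Yy Xy By xy => /(_ isT isT isT isT isT)[-> ->].
  by [].
have EQ : Ecut F Q.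
  have b1Q : b1 F \in Q by rewrite inE b1X.
  have a1Q : a1 F \notin Q by rewrite inE (negPf a1Y) andbF.
  have a2Q : a2 F \notin Q by rewrite inE (negPf a2Y) andbF.
  have b2Q : b2 F \in Q by rewrite inE b2X.
  apply: Ecut_le3 => //.
  have := cutE F Q; have := frame_count F Q.
  rewrite /sum_a /sum_b cQ b1Q b2Q (negPf a1Q) (negPf a2Q) /= => countQ cutQ.
  have insW_ge : sum_a F X <= ins F W + 1.
    have [a12|] := boolP ((a1 F \in X) && (a2 F \in X)); last first.
      by move: s12; rewrite /sum_a; do 2!case: (_ \in X); rewrite //=; clear; lia.
    have [a1X a2X] := andP a12.
    have a1W : a1 F \in W by rewrite inE a1X a1Y.
    have bW : b \notin W by rewrite inE bY.
    have := cut_ge3 F a1W bW; have := cutE F W; have := frame_count F W.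
    rewrite /sum_a /sum_b cW !inE a1X a2X a1Y a2Y (negPf b1X) (negPf b2X) ?andbF /=.
    by move: (ins _ _) (out _ _) (cut _) #|_|; clear; lia.
  move: total countQ cutQ insW_ge; rewrite iX'.
  by move: (ins _ _) (ins _ _) (out _ _) (cut _) (sum_a _ _) #|_|; clear; lia.
have [p [q [fpq Qp Qq Bq]]] := forced_out EQ.
have [Ap _ pq _] := and4P fpq.
have := outQ p q Qp Ap Qq Bq pq; rewrite inE => /andP[Xq Yq].
by exists p, q; move: Qp; rewrite inE => /andP[].
Qed.

(* In the second alternative uv is the only edge from the side outside D into D,
   and all but one of the edges leaving D are forced. *)
Definition blocked F u v := ~~ unsep F u v || [exists D : {set G},
  [&& witness F D u v, sum_a F D <= 1, 0 < sum_b F D, sum_a F D <= sum_b F D &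
      sum_b F D <= sum_a F D + #|leaving F D|]].

(** The certificate is the complement of [X]. As many forced edges entering [X] are needed as
    [sum_a F X] exceeds [sum_b F X]; each of the alternatives supplies enough of them. *)
Lemma implied_blocked F u v a b X : implies_edge F u v a b X ->
  [\/ a \in [:: a1 F; a2 F], b \in [:: b1 F; b2 F] |
     exists Y, implies_edge2 F u v a b Y] -> blocked F u v.
Proof.
move=> ie alt; apply/orP; right; apply/existsP; exists (~: X).
have [Aa Bb ab aX bX uX vX lX cX d4 iX] := ie.
have sums : [/\ 0 < sum_a F X, sum_b F X <= 1 & sum_b F X <= sum_a F X].
  have := cutE F X; have := leak_out lX; move: iX; rewrite d4 /sum_a /sum_b.
  move: (ins _ _) (out _ _) => i o; move: (_ \in X) (_ \in X) (_ \in X) (_ \in X).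
  by do 4!case; rewrite /=; clear; split; lia.
have [sa sb sab] := sums.
have ca : sum_a F (~: X) + sum_a F X = 2.
  by rewrite /sum_a !inE; do 2!case: (_ \in X).
have cb : sum_b F (~: X) + sum_b F X = 2.
  by rewrite /sum_b !inE; do 2!case: (_ \in X).
have wD : witness F (~: X) u v.
  rewrite /witness !inE negbK uX vX cutC d4 eqxx /=.
  have := card_coside F X; rewrite cX; move: #|_| #|_| #|_|; clear=> m n p e.
  by apply/eqP; lia.
have enough : sum_a F X <= sum_b F X + #|leaving F (~: X)|.
  have [le|lt] := leqP (sum_a F X) (sum_b F X); first by rewrite (leq_trans le) ?leq_addr.
  have alt' : (exists Y, implies_edge2 F u v a b Y) \/
      (sum_a F X = 1 /\ a \in [:: a1 F; a2 F] \/ sum_b F X = 1 /\ b \in [:: b1 F; b2 F]).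
    case: alt => [aF|bF|]; [right; left|right; right|by left]; split=> //.
      move: aF sa; rewrite /sum_a !inE => /orP[] /eqP ea; rewrite -ea (negPf aX);
        by case: (_ \in X).
    move: bF sb; rewrite /sum_b !inE => /orP[] /eqP eb; rewrite -eb bX;
      by case: (_ \in X).
  have lowY Y : sum_b F X = 0 -> implies_edge2 F u v a b Y -> exists p q,
      [/\ forced F p q, p \notin X, q \in X & q \in Y].
    move=> sb0 ieY; have [p [q [fpq Xp _ Xq Yq]]] := low_forced ie ieY sb0.
    by exists p, q.
  have low : sum_b F X = 0 -> exists p q, [/\ forced F p q, p \notin X & q \in X].
    move=> sb0.
    case: alt' => [[Y ieY]|[[_ aF]|[sb1 _]]]; last by rewrite sb0 in sb1.
      by have [p [q [? ? ? _]]] := lowY Y sb0 ieY; exists p, q.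
    exact: low_forced_adjacent ie aF sb0.
  have ieS := implies_edge_swap ie.
  have sbS : sum_a F X = 2 -> sum_b (swap_sides F) (~: X) = 0.
    by have := sum_b_swap F X; clear; lia.
  have leav p q : forced F p q -> p \notin X -> q \in X -> (p, q) \in leaving F (~: X).
    by move=> fpq Xp Xq; rewrite !inE fpq Xp Xq.
  case: (posnP (sum_b F X)) => [sb0|sb1].
    have [p [q [fpq Xp Xq]]] := low sb0; rewrite sb0 add0n.
    have [sa1|sa2] := leqP (sum_a F X) 1.
      by apply: leq_trans sa1 _; apply/card_gt0P; exists (p, q); apply: leav.
    have sa2' : sum_a F X = 2.
      by move: sa2 ca; move: (sum_a _ _) (sum_a _ _); clear; lia.
    case: alt' => [[Y ieY]|[[sa1 _]|[sb1 _]]]; last 2 first.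
    - by rewrite sa1 in sa2.
    - by rewrite sb0 in sb1.
    have [p1 [q1 [f1 Xp1 Xq1 Yq1]]] := lowY Y sb0 ieY.
    (* Two forced edges are needed. The second comes from exchanging the sides and differs from the
       first because its end in [X] lies outside [Y]. *)
    have [q2 [p2 []]] := low_forced ieS (implies_edge2_swap ieY) (sbS sa2').
    rewrite !inE negbK forced_swap => f2 Xq2 Yq2 Xp2 _.
    rewrite sa2'; apply/card_gt1P; exists (p1, q1), (p2, q2).
    split; [exact: leav | exact: leav|].
    by apply: contraNneq Yq2 => -[_ <-].
  have sa2' : sum_a F X = 2.
    by move: lt sb1 ca; move: (sum_a _ _) (sum_a _ _) (sum_b _ _); clear; lia.
  have [p [q [fpq Xp Xq]]] : exists p q, [/\ forced F p q, p \notin X & q \in X].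
    case: alt' => [[Y ieY]|[[sa1 _]|[_ bF]]].
    - have [q [p []]] := low_forced ieS (implies_edge2_swap ieY) (sbS sa2').
      by rewrite !inE negbK forced_swap => ? ? _ ? _; exists p, q.
    - by rewrite sa1 in sa2'.
    have [q [p []]] := low_forced_adjacent ieS bF (sbS sa2').
    by rewrite !inE negbK forced_swap => ? ? ?; exists p, q.
  have : 0 < #|leaving F (~: X)| by apply/card_gt0P; exists (p, q); apply: leav.
  by rewrite sa2'; move: sb1; clear; lia.
by apply/and5P; split=> //; move: enough sa sb sab ca cb; clear; lia.
Qed.

End Dependence.

(** * Perfect matchings through a given edge that avoid uv *)

Section PerfectMatchings.
Variable G : sgraph.
Implicit Types (F : frame G) (P Q W X : {set G}) (u v x y p q : G) (mu : G -> G).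

Definition partial_matching mu :=
  involutive mu /\ forall x, mu x != x -> adj x (mu x).

Definition graft mu p q := [fun x => mu x with p |-> q, q |-> p].

Lemma graft_matching mu p q : partial_matching mu -> mu p = p -> mu q = q ->
  adj p q -> partial_matching (graft mu p q).
Proof.
case=> inv madj mp mq pq.
have qp : q != p by apply: contraTneq pq => ->; rewrite adj_irrefl.
have fixE x y : mu x = x -> (mu y == x) = (y == x).
  by move=> mx; rewrite -{1}mx (inj_eq (inv_inj inv)).
split=> x; rewrite /graft /=.
  case: (eqVneq x p) => [->|xp]; first by rewrite (negPf qp) eqxx.
  case: (eqVneq x q) => [->|xq]; first by rewrite eqxx.
  by rewrite !fixE // (negPf xp) (negPf xq) inv.
case: (eqVneq x p) => [->|xp] //.
case: (eqVneq x q) => [->|xq] //; first by rewrite adj_sym.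
exact: madj.
Qed.

Lemma graft_moved mu p q x : p != q -> mu p = p -> mu q = q ->
  (graft mu p q x != x) = (mu x != x) || (x \in [:: p; q]).
Proof.
move=> pq mp mq; rewrite /graft /= !inE.
case: (eqVneq x p) => [->|xp]; first by rewrite eq_sym pq orbT.
by case: (eqVneq x q) => [->|xq]; rewrite ?pq ?orbT ?orbF.
Qed.

Lemma graft_l mu p q : graft mu p q p = q.
Proof. by rewrite /= eqxx. Qed.

Lemma graft_r mu p q : p != q -> graft mu p q q = p.
Proof. by rewrite /= eq_sym => /negPf->; rewrite eqxx. Qed.

Lemma graft_out mu p q x : x != p -> x != q -> graft mu p q x = mu x.
Proof. by move=> /= /negPf-> /negPf->. Qed.

Lemma adj_neq x y : adj x y -> x != y :> G.
Proof. by move=> xy; apply: contraTneq xy => ->; rewrite adj_irrefl. Qed.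

(** Hall's theorem in G - {e, f} without uv, [P] and [Q]. In the second alternative [W] is a
    violator together with its neighbours and [Q]. *)
Lemma hall_alternative F u v P Q : u \in side F -> P \subset side F ->
  [disjoint Q & side F] -> #|P| = #|Q| ->
  (exists mu, [/\ partial_matching mu, forall x, (mu x == x) = (x \in P :|: Q) &
      u \notin P -> mu u != v]) \/
  (exists W : {set G}, [/\ [disjoint P & W], Q \subset W,
      #|W :\: side F| < #|W :&: side F| + #|Q| & leak F u v W]).
Proof.
move=> Au sPA dQA cardPQ.
pose r x y := adj x y && ~~ ((x == u) && (y == v)).
pose A1 := side F :\: P; pose B1 := ~: side F :\: Q.
have sQB : Q \subset ~: side F by rewrite -disjoints_subset.
have cardAB : #|A1| = #|B1|.
  have := card_side F; rewrite -(cardsID P (side F)) -(cardsID Q (~: side F)).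
  by rewrite (setIidPr sPA) (setIidPr sQB) cardPQ -/A1 -/B1; clear; lia.
have sA1 : A1 \subset side F by apply: subsetDl.
have dB1 : [disjoint B1 & side F].
  by rewrite disjoints_subset; apply: subsetDl.
have [/existsP[S /andP[sS ltS]]|] :=
    boolP [exists S : {set G}, (S \subset A1) && (#|neighbours r B1 S| < #|S|)].
  right; set T := neighbours r B1 S in ltS.
  have SA x : x \in S -> (x \in side F) && (x \notin P).
    by move/(subsetP sS); rewrite !inE andbC.
  have TB y : y \in T -> (y \notin side F) && (y \notin Q).
    by rewrite !inE => /andP[/andP[-> ->]].
  have QB y : y \in Q -> y \notin side F by move/(subsetP sQB); rewrite inE.
  exists (S :|: T :|: Q); split.
  - rewrite disjoints_subset; apply/subsetP => x Px; rewrite !in_setC !in_setU.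
    have Ax := subsetP sPA _ Px; apply/negP => /orP[/orP[/SA|/TB]|/QB];
      by rewrite ?Px ?Ax /= ?andbF.
  - exact: subsetUr.
  - have -> : (S :|: T :|: Q) :&: side F = S.
      apply/setP => x; rewrite in_setI !in_setU.
      apply/andP/idP => [[/orP[/orP[//|/TB]|/QB]]|Sx].
      + by case/andP=> /negPf->.
      + by move/negPf->.
      by rewrite Sx; case/andP: (SA _ Sx).
    have -> : (S :|: T :|: Q) :\: side F = T :|: Q.
      apply/setP => x; rewrite in_setD !in_setU.
      case Ax: (x \in side F) => /=.
        apply/esym/negbTE; rewrite negb_or.
        by apply/andP; split; apply/negP; [move/TB | move/QB]; rewrite Ax.
      by case Sx: (x \in S) => //; have := SA _ Sx; rewrite Ax.
    have := leq_card_setU T Q => -[le _].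
    by apply: leq_ltn_trans le _; rewrite ltn_add2r.
  move=> x y; rewrite !in_setU !negb_or => + Ax + By xy.
  case/orP=> [/orP[Sx|/TB]|/QB]; rewrite ?Ax //.
  case/andP=> /andP[_ Ty] Qy.
  have : ~~ r x y.
    apply: contra Ty => rxy; rewrite !inE Qy By /=.
    by apply/existsP; exists x; rewrite Sx.
  by rewrite /r xy /= negbK => /andP[/eqP-> /eqP->].
rewrite negb_exists => /forallP noS; left.
have hallAB (S : {set G}) : S \subset A1 -> #|S| <= #|neighbours r B1 S|.
  by move=> sS; have := noS S; rewrite sS /= -leqNgt.
have sub_r : subrel r (@adj G) by move=> x y /andP[].
have [mu [[inv madj flip] moved rmu]] := hall_pairing sub_r sA1 dB1 cardAB hallAB.
exists mu; split=> // [x|Pu].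
  have := moved x; rewrite !inE.
  have := subsetP sPA x; have := subsetP sQB x; rewrite inE.
  case: (x \in P); case: (x \in Q); case: (x \in side F); case: (mu x == x) => //=;
    by [move=> /(_ isT) | move=> _ /(_ isT)].
have : r u (mu u) by apply: rmu; rewrite inE Pu.
by rewrite /r eqxx => /andP[].
Qed.

Definition perfect_pairing mu := involutive mu /\ forall x, adj x (mu x).

Lemma perfect_pairingP mu : partial_matching mu -> (forall x, mu x != x) ->
  perfect_pairing mu.
Proof. by case=> inv madj moved; split=> // x; apply: madj. Qed.

Section Unblocked.
Variables (F : frame G) (u v : G).
Hypotheses (Au : u \in side F) (Bv : v \notin side F).
Hypothesis nblocked : ~~ blocked F u v.

Let unsep_uv : unsep F u v.
Proof. by apply: contraNT nblocked => nuv; rewrite /blocked nuv. Qed.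

(** The edge leaving such a cut would have to be uv, but an unblocked edge lies in no 3-edge cut
    separating f from e. *)
Lemma leak_not_Ecut X : leak F u v X -> ~~ Ecut F X.
Proof.
move=> lX; apply/negP => EX; have [_ oX _] := Ecut_count EX.
have := leak_out0 lX; rewrite (unsepP _ _ _ unsep_uv _ EX) oX.
by case: (v \in X) => /(_ isT).
Qed.

Let a1A := a1_side F.
Let a2A := a2_side F.
Let b1A : b1 F \notin side F. Proof. by have := b1_side F; rewrite inE. Qed.
Let b2A : b2 F \notin side F. Proof. by have := b2_side F; rewrite inE. Qed.
Let neq_ab x y : x \in side F -> y \notin side F -> x != y.
Proof. by move=> Ax; apply: contraNneq => <-. Qed.
Let neq_ba x y : x \in side F -> y \notin side F -> y != x.
Proof. by rewrite eq_sym; exact: neq_ab. Qed.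
Let na := adj_neq (adj_a F).
Let nb := adj_neq (adj_b F).

Lemma matching_through_ab : exists mu, [/\ perfect_pairing mu,
  mu (a1 F) = a2 F, mu (b1 F) = b2 F & mu u != v].
Proof.
have sPA : [set a1 F; a2 F] \subset side F.
  by apply/subsetP => x /set2P[]->.
have dQA : [disjoint [set b1 F; b2 F] & side F].
  by rewrite disjoints_subset; apply/subsetP => x /set2P[]->; rewrite inE.
have cPQ : #|[set a1 F; a2 F]| = #|[set b1 F; b2 F]| by rewrite !cards2 na nb.
case: (hall_alternative v Au sPA dQA cPQ) => [[mu [pmu fixed muu]]|[W []]].
  have fx x : x \in [set a1 F; a2 F] :|: [set b1 F; b2 F] -> mu x = x.
    by rewrite -fixed => /eqP.
  have fa1 : mu (a1 F) = a1 F by apply: fx; rewrite !inE eqxx.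
  have fa2 : mu (a2 F) = a2 F by apply: fx; rewrite !inE eqxx orbT.
  have fb1 : mu (b1 F) = b1 F by apply: fx; rewrite !inE eqxx !orbT.
  have fb2 : mu (b2 F) = b2 F by apply: fx; rewrite !inE eqxx !orbT.
  pose mu1 := graft mu (a1 F) (a2 F).
  have f1b1 : mu1 (b1 F) = b1 F by rewrite /mu1 graft_out // neq_ba.
  have f1b2 : mu1 (b2 F) = b2 F by rewrite /mu1 graft_out // neq_ba.
  have pmu1 : partial_matching mu1 by apply: graft_matching; rewrite // adj_a.
  exists (graft mu1 (b1 F) (b2 F)); split.
  - apply: perfect_pairingP; first by apply: graft_matching; rewrite // adj_b.
    move=> x; rewrite graft_moved // graft_moved // -!orbA !inE fixed !inE.
    by do 4!case: (x == _).
  - by rewrite graft_out ?neq_ab // /mu1 graft_l.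
  - by rewrite graft_l.
  have -> : graft mu1 (b1 F) (b2 F) u = mu1 u by rewrite graft_out ?neq_ab.
  have [->|u1] := eqVneq u (a1 F); first by rewrite /mu1 graft_l neq_ab.
  have [->|u2] := eqVneq u (a2 F); first by rewrite /mu1 graft_r // neq_ab.
  by rewrite /mu1 graft_out // muu // !inE negb_or u1.
rewrite disjoints_subset => /subsetP dPW /subsetP sQW cW lW.
have a1W : a1 F \notin W by have := dPW (a1 F); rewrite !inE eqxx => ->.
have a2W : a2 F \notin W by have := dPW (a2 F); rewrite !inE eqxx orbT => ->.
have b1W : b1 F \in W by apply: sQW; rewrite !inE eqxx.
have b2W : b2 F \in W by apply: sQW; rewrite !inE eqxx orbT.
case/negP: (leak_not_Ecut lW); apply: Ecut_le3 => //.
have := cutE F W; have := frame_count F W; have := leak_out lW; move: cW.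
rewrite /sum_a /sum_b b1W b2W (negPf a1W) (negPf a2W) cards2 nb /=.
by move: (ins _ _) (out _ _) (cut _) #|_| #|_|; clear; lia.
Qed.

(** The matching is first sought without e and f. If that fails with a deficient set [X], then a is
    not an end of e and b not an end of f, as uv is unblocked, and a matching through ab, e and f is
    sought. A second deficient set would again block uv. *)
Lemma matching_through_side a b : a \in side F -> b \notin side F -> adj a b ->
  (a, b) != (u, v) -> exists mu, [/\ perfect_pairing mu, mu a = b & mu u != v].
Proof.
move=> Aa Bb ab neq; have nab := neq_ab Aa Bb.
have sPA : [set a] \subset side F by rewrite sub1set.
have dQA : [disjoint [set b] & side F].
  by rewrite disjoints_subset sub1set inE.
have cPQ : #|[set a]| = #|[set b]| by rewrite !cards1.
have avoid mu : (u != a -> mu u != v) -> graft mu a b u != v.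
  move=> muu; have [eu|ua] := eqVneq u a.
    by rewrite {1}eu graft_l; apply: contra neq => /eqP->; rewrite eu eqxx.
  have -> : graft mu a b u = mu u by rewrite graft_out // neq_ab.
  exact: muu.
case: (hall_alternative v Au sPA dQA cPQ) => [[mu [pmu fixed muu]]|[X []]].
  have fa : mu a = a by apply/eqP; rewrite fixed !inE eqxx.
  have fb : mu b = b by apply/eqP; rewrite fixed !inE eqxx orbT.
  exists (graft mu a b); split; last by apply: avoid => ua; rewrite muu // inE.
    apply: perfect_pairingP; first exact: graft_matching.
    move=> x; rewrite graft_moved // fixed !inE.
    by case: (x == a); case: (x == b).
  by rewrite graft_l.
rewrite disjoints_subset sub1set inE sub1set cards1 => aX bX cX lX.
have iX := ins_gt0 Aa Bb ab aX bX.
have ieX : implies_edge F u v a b X.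
  have nums : [/\ #|X :\: side F| = #|X :&: side F|, out F X = 1, cut X = 4 &
      ins F X + sum_b F X = 1 + sum_a F X].
    have := cutE F X; have := frame_count F X; have := leak_out lX.
    have := cut_ge3 F bX aX; move: cX iX; rewrite /sum_a /sum_b.
    move: (ins _ _) (out _ _) (cut _) #|_| #|_|; clear=> i o d c e.
    move: (_ \in X) (_ \in X) (_ \in X) (_ \in X).
    by do 4!case; rewrite /=; clear; split; lia.
  have [eX oX dX sX] := nums.
  have /andP[uX vX] : (u \in X) && (v \notin X).
    by apply/negPn/negP => /(leak_out0 lX); rewrite oX.
  by split.
have blk alt := negP nblocked (implied_blocked ieX alt).
have na_ : a \notin [:: a1 F; a2 F] by apply/negP => aF; apply: blk; constructor 1.
have nb_ : b \notin [:: b1 F; b2 F] by apply/negP => bF; apply: blk; constructor 2.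
move: (na_) (nb_); rewrite !inE !negb_or => /andP[aa1 aa2] /andP[bb1 bb2].
pose P := a |: [set a1 F; a2 F]; pose Q := b |: [set b1 F; b2 F].
have sPA' : P \subset side F.
  by apply/subsetP => x; rewrite !inE => /or3P[]/eqP->.
have dQA' : [disjoint Q & side F].
  by rewrite disjoints_subset; apply/subsetP => x; rewrite !inE => /or3P[]/eqP->.
have cQ : #|Q| = 3 by rewrite cardsU1 cards2 nb !inE negb_or bb1 bb2.
have cP : #|P| = #|Q| by rewrite cQ cardsU1 cards2 na !inE negb_or aa1 aa2.
case: (hall_alternative v Au sPA' dQA' cP) => [[mu [pmu fixed muu]]|[W []]].
  have fx x : x \in P :|: Q -> mu x = x by rewrite -fixed => /eqP.
  have fa : mu a = a by apply: fx; rewrite !inE eqxx.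
  have fa1 : mu (a1 F) = a1 F by apply: fx; rewrite !inE eqxx !orbT.
  have fa2 : mu (a2 F) = a2 F by apply: fx; rewrite !inE eqxx !orbT.
  have fb : mu b = b by apply: fx; rewrite !inE eqxx !orbT.
  have fb1 : mu (b1 F) = b1 F by apply: fx; rewrite !inE eqxx !orbT.
  have fb2 : mu (b2 F) = b2 F by apply: fx; rewrite !inE eqxx !orbT.
  pose mu1 := graft mu (a1 F) (a2 F); pose mu2 := graft mu1 (b1 F) (b2 F).
  have f1b1 : mu1 (b1 F) = b1 F by rewrite /mu1 graft_out // neq_ba.
  have f1b2 : mu1 (b2 F) = b2 F by rewrite /mu1 graft_out // neq_ba.
  have f2a : mu2 a = a by rewrite /mu2 graft_out ?neq_ab // /mu1 graft_out.
  have f2b : mu2 b = b.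
    by rewrite /mu2 graft_out // /mu1 graft_out // neq_ba.
  have pmu1 : partial_matching mu1 by apply: graft_matching; rewrite // adj_a.
  have pmu2 : partial_matching mu2 by apply: graft_matching; rewrite // adj_b.
  exists (graft mu2 a b); split.
  - apply: perfect_pairingP; first exact: graft_matching.
    move=> x; rewrite graft_moved // graft_moved // graft_moved //.
    by rewrite fixed !inE; do 6!case: (x == _).
  - by rewrite graft_l.
  apply: avoid => ua.
  have -> : mu2 u = mu1 u by rewrite /mu2 graft_out ?neq_ab.
  have [->|u1] := eqVneq u (a1 F); first by rewrite /mu1 graft_l neq_ab.
  have [->|u2] := eqVneq u (a2 F); first by rewrite /mu1 graft_r // neq_ab.
  by rewrite /mu1 graft_out // muu // !inE !negb_or ua u1.
rewrite disjoints_subset cQ => /subsetP dPW /subsetP sQW cW lW.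
have aW : a \notin W by have := dPW a; rewrite !inE eqxx => ->.
have a1W : a1 F \notin W by have := dPW (a1 F); rewrite !inE eqxx orbT => ->.
have a2W : a2 F \notin W by have := dPW (a2 F); rewrite !inE eqxx !orbT => ->.
have bW : b \in W by apply: sQW; rewrite !inE eqxx.
have b1W : b1 F \in W by apply: sQW; rewrite !inE eqxx !orbT.
have b2W : b2 F \in W by apply: sQW; rewrite !inE eqxx !orbT.
have [d3|d4] := leqP (cut W) 3.
  by case/negP: (leak_not_Ecut lW); apply: Ecut_le3.
exfalso; apply: blk; constructor 3; exists W; split=> //.
have := cutE F W; have := frame_count F W; have := leak_out lW; move: cW d4.
rewrite /sum_a /sum_b b1W b2W (negPf a1W) (negPf a2W) /=.
by move: (ins _ _) (out _ _) (cut _) #|_| #|_|; clear; lia.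
Qed.

Lemma matching_through x y : adj x y -> [set x; y] != [set u; v] ->
  exists mu, [/\ perfect_pairing mu, mu x = y & mu u != v].
Proof.
have [mu [[inv madj] mua mub muu]] := matching_through_ab.
have muba : mu (a2 F) = a1 F by rewrite -mua inv.
have mubb : mu (b2 F) = b1 F by rewrite -mub inv.
move=> xy neq.
have [Ax|Bx] := boolP (x \in side F); have [Ay|By] := boolP (y \in side F).
- have := adj_side Ax Ay xy; rewrite !inE => /orP[]/eqP[-> ->];
    by exists mu.
- apply: matching_through_side => //.
  by apply: contra neq => /eqP[-> ->].
- have [||||nu [[invn nadj] nuy nuu]] := @matching_through_side y x.
  + by [].
  + by [].
  + by rewrite adj_sym.
  + by apply: contra neq => /eqP[-> ->]; rewrite setUC.
  by exists nu; split=> //; rewrite -nuy invn.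
have := @adj_coside _ F x y; rewrite !inE Bx By xy => /(_ isT isT isT).
by case/orP=> /eqP[-> ->]; exists mu.
Qed.

End Unblocked.
End PerfectMatchings.

(** * From involutions to sets of edges *)

Section Removable.
Variable G : sgraph.
Implicit Types (F : frame G) (P Q W X Z D : {set G}) (u v x y p q : G).
Implicit Types (mu : G -> G).

Lemma edgesP (e : {set G}) :
  reflect (exists x y, adj x y /\ e = [set x; y]) (e \in edges G).
Proof.
rewrite inE; apply: (iffP existsP) => [[x /existsP[y /andP[xy /eqP]]]|].
  by exists x, y.
by case=> x [y [xy ->]]; exists x; apply/existsP; exists y; rewrite xy eqxx.
Qed.

Lemma set2_inj x y u v : [set x; y] = [set u; v] :> {set G} ->
  (x = u /\ y = v) \/ (x = v /\ y = u).
Proof.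
move=> e; have xin : x \in [set u; v] by rewrite -e set21.
have yin : y \in [set u; v] by rewrite -e set22.
have uin : u \in [set x; y] by rewrite e set21.
have vin : v \in [set x; y] by rewrite e set22.
by case/set2P: xin; case/set2P: yin; case/set2P: uin; case/set2P: vin; intros;
  subst; auto.
Qed.

Lemma pairing_edge mu x z : involutive mu -> z \in [set x; mu x] ->
  [set x; mu x] = [set z; mu z].
Proof. by move=> inv /set2P[]->; rewrite ?inv // setUC. Qed.

Lemma pairing_matching mu (A : {pred G}) : involutive mu ->
  {in A, forall x, adj x (mu x)} -> matching [set [set x; mu x] | x in A].
Proof.
move=> inv madj; apply/andP; split.
  apply/subsetP => e /imsetP[x Ax ->]; apply/edgesP.
  by exists x, (mu x); split=> //; apply: madj.
apply/trivIsetP => _ _ /imsetP[x Ax ->] /imsetP[y Ay ->]; apply: contraR.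
rewrite -setI_eq0 => /set0Pn[z /setIP[xz yz]].
by rewrite (pairing_edge inv xz) (pairing_edge inv yz).
Qed.

End Removable.

Lemma perfect_pairing_matching (G : sgraph) (mu : G -> G) :
  perfect_pairing mu -> perfect_matching [set [set x; mu x] | x : G].
Proof.
case=> inv madj; apply/andP; split; first by apply: pairing_matching.
apply/eqP/setP => x; rewrite inE; apply/bigcupP.
by exists [set x; mu x]; rewrite ?set21 //; apply/imsetP; exists x.
Qed.

Section Unblocked.
Variable G : sgraph.
Implicit Types (F : frame G) (P Q W X Z D : {set G}) (u v x y p q : G).
Implicit Types (mu : G -> G).

Lemma unblocked_removable F u v : k_edge_connected 3 G -> u \in side F ->
  v \notin side F -> adj u v -> ~~ blocked F u v -> removable [set u; v].
Proof.
case/andP=> _ /forallP conn Au Bv uv nb.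
have Euv : [set u; v] \in edges G by apply/edgesP; exists u, v.
rewrite /removable Euv /=; apply/andP; split.
  by have := conn [set [set u; v]]; rewrite sub1set Euv cards1.
apply/forall_inP => h /edgesP[x [y [/andP[xy]]]]; rewrite inE => neq ->.
have [mu [[inv madj] mux muu]] := matching_through Au Bv nb xy neq.
apply/existsP; exists [set [set z; mu z] | z : G]; apply/andP; split; last first.
  by apply/imsetP; exists x; rewrite ?mux.
apply: (@perfect_pairing_matching (del_edges [set [set u; v]]) mu); split=> // z.
rewrite /= /del_adj madj inE /=; apply: contra muu => /eqP/set2_inj[[eu ev]|[ev eu]].
  by rewrite -eu -ev.
by rewrite -eu inv ev.
Qed.

End Unblocked.

(** * Counting the non-removable edges of the matchings *)

Section Bounds.
Variable G : sgraph.
Implicit Types (F : frame G) (P Q W X Z D : {set G}) (u v x y p q : G).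
Implicit Types (mu : G -> G).

Lemma trapped_eq F F' Z : side F = side F' -> a1 F = a1 F' -> a2 F = a2 F' ->
  (b1 F = b1 F' /\ b2 F = b2 F') \/ (b1 F = b2 F' /\ b2 F = b1 F') ->
  trapped F Z = trapped F' Z.
Proof.
move=> eA e1 e2 eb.
have eEcut X : Ecut F X = Ecut F' X.
  by rewrite /Ecut e1 e2; case: eb => -[-> ->] //; rewrite andbCA.
have eu u v : unsep F u v = unsep F' u v.
  by apply: eq_forallb => X; rewrite eEcut.
apply: eq_existsb => D; apply: eq_existsb => u; apply: eq_existsb => v.
rewrite /witness eA e1 e2 eu; congr (_ && _).
by case: eb => -[-> ->] //; congr [&& _, _, _ & _]; rewrite andbC.
Qed.

(** A trap at the upper end depends on which end of e is a1 but not on the order of b1 and b2, and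
    conversely at the lower end; so the two choices are independent. *)
Lemma choose_frame F X Y : Ecut F X -> Ecut F Y -> exists F' : frame G,
  [/\ side F' = side F, forall Z, Ecut F' Z = Ecut F Z,
      ~~ trapped F' X & ~~ trapped (swap_sides F') (~: Y)].
Proof.
move=> EX EY.
have Eb F1 Z : Ecut (swap_b F1) Z = Ecut F1 Z.
  by rewrite /Ecut /= andbCA.
have [F1 [side1 E1 nX]] : exists F' : frame G, [/\ side F' = side F,
    forall Z, Ecut F' Z = Ecut F Z & ~~ trapped F' X].
  have [tX|nX] := boolP (trapped F X); last by exists F.
  exists (swap_a F); split=> // [Z|]; first exact: Ecut_swap_a.
  by apply/negP; exact: trapped_swap_a EX tX.
have [tY|nY] := boolP (trapped (swap_sides F1) (~: Y)); last by exists F1.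
have eX : trapped (swap_b F1) X = trapped F1 X by apply: trapped_eq; auto.
have eY : trapped (swap_sides (swap_b F1)) (~: Y)
    = trapped (swap_a (swap_sides F1)) (~: Y) by apply: trapped_eq; auto.
exists (swap_b F1); split; first exact: side1.
- by move=> Z; rewrite Eb.
- by rewrite eX.
rewrite eY; apply/negP; apply: (@trapped_swap_a _ (swap_sides F1)) tY.
by rewrite Ecut_swap E1.
Qed.

Lemma leaving_swap F D : #|leaving (swap_sides F) (~: D)| = #|leaving F D|.
Proof.
have swapK : involutive (fun p : G * G => (p.2, p.1)) by case.
rewrite -(card_imset _ (inv_inj swapK)); apply: eq_card => -[p q].
rewrite inE /=; apply/imsetP/idP => [[[x y]]|/and3P[fpq Dp Dq]].
  rewrite !inE /= negbK forced_swap => /and3P[fyx Dx Dy] [-> ->].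
  by rewrite fyx Dy Dx.
by exists (q, p); rewrite // !inE /= forced_swap fpq Dp Dq.
Qed.

(** The count of [near_witness] sorts the certificates by the ends of e and f that they contain.
    Only one separating both a1 from a2 and b1 from b2 could have uv between [Y] and [X]. *)
Lemma near_blocked F X Y mu u : Ecut F X -> Ecut F Y -> Y \subset X ->
  near_perfect F mu -> u \in side F -> mu u != u -> blocked F u (mu u) ->
  top_blocked F X u (mu u) \/ top_blocked (swap_sides F) (~: Y) (mu u) u.
Proof.
move=> EX EY sYX nmu Au mu_u.
have [inv madj flip] := near_pairing nmu.
have Bv : mu u \notin side F by rewrite flip // Au.
have sep Z : Ecut F Z -> (u \in Z) = (mu u \in Z).
  by move=> EZ; rewrite (near_Ecut nmu).
case/orP=> [/negP[]|]; first by apply/unsepP.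
case/existsP=> D /and5P[wD sa sb sab lD].
have nw := near_witness nmu Au wD.
have [i1 o1] := witness_ins_out wD sa sb.
have room : (b1 F \in D) + #|leaving F D| + sum_a F D <= sum_b F D + (a1 F \in D).
  by move: nw o1; move: (out _ _) (sum_a _ _) (sum_b _ _) #|_|
    (nat_of_bool _) (nat_of_bool _); clear; lia.
have sa_b : (a1 F \in D) <= sum_a F D by rewrite leq_addr.
have [a0|a0] := posnP (sum_a F D).
  have a1D : a1 F \notin D by move: a0; rewrite /sum_a; case: (_ \in D).
  have a2D : a2 F \notin D by move: a0; rewrite /sum_a; do 2!case: (_ \in D).
  have b1D : b1 F \notin D.
    apply/negP => b1D; move: room lD; rewrite a0 (negPf a1D) b1D.
    by move: (sum_b _ _) #|_|; clear; lia.
  have b2D : b2 F \in D.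
    by move: sb; rewrite /sum_b (negPf b1D); case: (_ \in D).
  right; exists (~: D); rewrite witness_swap leaving_swap /= !inE a1D a2D.
  rewrite b2D (negPf b1D); split=> //; left; split=> //.
  by move: lD; rewrite a0 /sum_b b2D (negPf b1D).
have one_a : (a1 F \in D) != (a2 F \in D).
  by move: a0 sa; rewrite /sum_a; do 2!case: (_ \in D).
have a1' : sum_a F D = 1 by move: a0 sa; clear; lia.
have [b12|nb12] := boolP ((b1 F \in D) && (b2 F \in D)).
  have [b1D b2D] := andP b12; left; exists D; split=> //; left; split=> //.
  by move: lD; rewrite a1' /sum_b b1D b2D; clear; lia.
have one_b : (b1 F \in D) != (b2 F \in D).
  by move: nb12 sb; rewrite /sum_b; do 2!case: (_ \in D).
have [uX|uX] := boolP (u \in X); last first.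
  by left; exists D; split=> //; right; split=> //; rewrite -sep.
have [uY|uY] := boolP (u \in Y).
  right; exists (~: D); rewrite witness_swap /= !inE; split=> //.
    by move: one_b; do 2!case: (_ \in D).
  right; rewrite !negbK -sep // uY; split=> //.
  by move: one_a; do 2!case: (_ \in D).
have vX : mu u \in X by rewrite -sep.
have vY : mu u \notin Y by rewrite -sep.
have [Du Dv _ _] := and4P wD.
(* The cut of [D] would have at least five edges: two inside [Y], two outside [X], and uv in
   between. *)
have inY := split_Ecut EY one_b.
have outX : 2 <= ec (~: X :&: ~: D) (~: X :\: ~: D).
  apply: (@split_Ecut _ (swap_sides F)); first by rewrite Ecut_swap.
  by rewrite /= !inE; move: one_a; do 2!case: (_ \in D).
have [_ d4 _] := witness_count wD.
have sub1 : ec (Y :&: D) (Y :\: D) <= ec (D :&: Y) (~: D).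
  by apply: ec_sub; rewrite ?[Y :&: D]setIC // setDE subsetIr.
have sub2 : ec (~: X :&: ~: D) (~: X :\: ~: D) <= ec (D :\: Y :\: X) (~: D).
  rewrite ecC; apply: ec_sub; last exact: subsetIr.
  apply/subsetP => z; rewrite !inE negbK => /andP[-> Xz]; rewrite Xz.
  by rewrite andbT; apply: contra Xz; apply: (subsetP sYX).
have mid : 0 < ec ((D :\: Y) :&: X) (~: D).
  apply: (@ec_gt0 _ _ _ (mu u) u); rewrite ?inE ?vY ?Dv ?vX //.
  by rewrite adj_sym madj.
move: d4; rewrite /cut (ec_splitl Y) (ec_splitl X (D :\: Y)).
by move: inY outX sub1 sub2 mid; clear; lia.
Qed.

Definition good F mu :=
  [set u in side F | (mu u != u) && removable [set u; mu u]].

Lemma good_matching F mu : pairing F mu -> exists M : {set {set G}},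
  [/\ matching M, #|M| = #|good F mu| &
      forall e : {set G}, e \in M -> removable e].
Proof.
case=> inv madj flip; exists [set [set x; mu x] | x in good F mu]; split.
- by apply: pairing_matching => // x; rewrite inE => /and3P[_ /madj].
- rewrite card_in_imset // => x y; rewrite !inE => /and3P[Ax mx _] /and3P[Ay my _].
  move=> e; have : y \in [set x; mu x] by rewrite e set21.
  by case/set2P=> // ey; move: Ay; rewrite ey flip // Ax.
by move=> e /imsetP[x]; rewrite inE => /and3P[_ _ rx] ->.
Qed.

Lemma good_card F mu n : #|[set u in side F | mu u == u]| +
    #|[set u in side F | (mu u != u) && ~~ removable [set u; mu u]]| <= n ->
  #|side F| <= #|good F mu| + n.
Proof.
move=> le_n; rewrite -(cardsID (good F mu)).
have -> : side F :&: good F mu = good F mu.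
  by apply/setP => u; rewrite !inE; case: (u \in side F).
rewrite leq_add2l; apply: leq_trans le_n; apply: leq_trans (leq_card_setU _ _).
apply/subset_leq_card/subsetP => u; rewrite !inE.
by case: (u \in side F); case: (mu u == u); case: removable.
Qed.

Lemma near_bound F X Y mu : k_edge_connected 3 G -> Ecut F X -> Ecut F Y ->
  (forall Z, Ecut F Z -> Z \subset X) -> (forall Z, Ecut F Z -> Y \subset Z) ->
  ~~ trapped F X -> ~~ trapped (swap_sides F) (~: Y) -> near_perfect F mu ->
  #|side F| <= #|good F mu| + 3.
Proof.
move=> conn EX EY maxX minY nX nY nmu.
have [inv madj flip] := near_pairing nmu.
(* One side vertex is uncovered, and at most one edge is blocked at each end of the chain. *)
apply: good_card; rewrite -[3]/(1 + 2); apply: leq_add.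
  have -> : [set u in side F | mu u == u] = [set a1 F]; last by rewrite cards1.
  apply/setP => u; rewrite !inE (near_fixed nmu) !inE.
  case: eqVneq => [->|_]; first by rewrite a1_side.
  by case: eqVneq => [->|_]; rewrite ?andbF //; have := b1_side F; rewrite inE => /negPf->.
(* Of three blocked edges two would be blocked at the same end. *)
rewrite leqNgt; apply/negP => /card_gt2P[u [v [w [[Bu Bv Bw] [uv vw wu]]]]].
have bad z : z \in [set u in side F |
      (mu u != u) && ~~ removable [set u; mu u]] ->
    [/\ z \in side F, mu z != z &
     top_blocked F X z (mu z) \/ top_blocked (swap_sides F) (~: Y) (mu z) z].
  rewrite inE => /and3P[Az mz nrem]; split=> //.
  apply: near_blocked => //; first exact: minY.
  apply: contraR nrem => nb; apply: unblocked_removable nb => //.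
    by rewrite flip // Az.
  exact: madj.
have [Au mu_u tu] := bad u Bu; have [Av mu_v tv] := bad v Bv.
have [Aw mu_w tw] := bad w Bw.
have same1 x y : x \in side F -> mu x != x -> y \in side F -> mu y != y ->
    top_blocked F X x (mu x) -> top_blocked F X y (mu y) -> x = y.
  by move=> *; apply: (top_unique EX maxX nX nmu).
have same2 x y : x \in side F -> mu x != x -> y \in side F -> mu y != y ->
    top_blocked (swap_sides F) (~: Y) (mu x) x ->
    top_blocked (swap_sides F) (~: Y) (mu y) y -> x = y.
  move=> Ax mx Ay my.
  rewrite -{2}(inv x) -{2}(inv y) => tx ty.
  apply: (inv_inj inv); apply: (top_unique _ _ nY (near_swap nmu) _ _ _ _ tx ty).
  - by rewrite Ecut_swap.
  - move=> Z EZ; rewrite -setCS setCK; apply: minY.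
    by rewrite -Ecut_swap setCK.
  - by rewrite /= inE flip // Ax.
  - by rewrite inv eq_sym.
  - by rewrite /= inE flip // Ay.
  - by rewrite inv eq_sym.
case: tu tv tw => tu [] tv [] tw.
- by case/eqP: uv; apply: same1.
- by case/eqP: uv; apply: same1.
- by case/eqP: wu; apply: same1.
- by case/eqP: vw; apply: same2.
- by case/eqP: vw; apply: same1.
- by case/eqP: wu; apply: same2.
- by case/eqP: uv; apply: same2.
by case/eqP: uv; apply: same2.
Qed.

Lemma Ecut_bound F X0 : k_edge_connected 3 G -> Ecut F X0 -> exists F' mu,
  [/\ side F' = side F, pairing F' mu & #|side F'| <= #|good F' mu| + 3].
Proof.
move=> conn EX0.
case: (@arg_maxnP _ X0 (Ecut F) (fun Z => #|Z|) EX0) => X EX maxX.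
case: (@arg_minnP _ X0 (Ecut F) (fun Z => #|Z|) EX0) => Y EY minY.
have [F' [sideF' EF' nX nY]] := choose_frame EX EY.
have [mu nmu] := near_perfect_exists F'; exists F', mu; split=> //.
  exact: near_pairing nmu.
apply: (@near_bound F' X Y) => // [||Z|Z]; rewrite ?EF' // => EZ.
  case: (Ecut_nested EZ EX) => // sXZ; have := maxX Z EZ => /= le.
  by rewrite (_ : X = Z) //; apply/eqP; rewrite eqEcard sXZ.
case: (Ecut_nested EY EZ) => // sZY; have := minY Z EZ => /= le.
by rewrite (_ : Z = Y) //; apply/eqP; rewrite eqEcard sZY.
Qed.

(** Without separating 3-edge cuts there are no forced edges, so the inequalities on [D] leave
    exactly one end of e and one end of f in it. *)
Lemma noEcut_blocked F mu u : (forall Z, ~~ Ecut F Z) -> blocked F u (mu u) ->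
  exists D, (u \in D) != (mu u \in D) /\ (sep11 F D || sep11 (swap_b F) D).
Proof.
move=> noE /orP[/negP[]|].
  by apply/unsepP => Z EZ; have := noE Z; rewrite EZ.
case/existsP=> D /and5P[wD sa sb sab].
have -> : leaving F D = set0.
  apply/setP => p; rewrite !inE; apply/negP => /and3P[/and4P[_ _ _ /existsP[Z]]].
  by case/and3P=> EZ; have := noE Z; rewrite EZ.
rewrite cards0 addn0 => sba.
have [Du Dv /eqP d4 _] := and4P wD.
have one_a : (a1 F \in D) != (a2 F \in D).
  by move: sa sb sab sba; rewrite /sum_a /sum_b; do 4!case: (_ \in D).
have one_b : (b1 F \in D) != (b2 F \in D).
  by move: sa sb sab sba; rewrite /sum_a /sum_b; do 4!case: (_ \in D).
exists (if a1 F \in D then D else ~: D).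
case: ifPn => a1D; rewrite ?inE (negPf Du) Dv; split=> //.
  rewrite /sep11 /= d4 a1D eqxx !andbT.
  by move: one_a one_b; rewrite a1D; do 3!case: (_ \in D).
rewrite /sep11 /= cutC d4 !inE a1D eqxx !andbT !negbK.
by move: one_a one_b; rewrite (negPf a1D); do 3!case: (_ \in D).
Qed.

Lemma noEcut_bound F : k_edge_connected 3 G -> (forall Z, ~~ Ecut F Z) ->
  exists F' mu,
  [/\ side F' = side F, pairing F' mu & #|side F'| <= #|good F' mu| + 3].
Proof.
move=> conn noE.
have bad F1 mu u : side F1 = side F -> pairing F1 mu ->
    u \in [set u in side F1 | (mu u != u) && ~~ removable [set u; mu u]] ->
    exists D, (u \in D) != (mu u \in D) /\ (sep11 F D || sep11 (swap_b F) D).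
  move=> e1 [inv madj flip]; rewrite inE => /and3P[Au mu_u nrem].
  apply: noEcut_blocked => //; apply: contraR nrem => nb.
  apply: unblocked_removable nb => //; [by rewrite -e1| |exact: madj].
  by rewrite -e1 flip // Au.
have fix0 F1 mu : (forall x, mu x != x) -> #|[set u in side F1 | mu u == u]| = 0.
  move=> moved; apply/eqP; rewrite cards_eq0; apply/eqP/setP => u.
  by rewrite !inE (negPf (moved u)) andbF.
(* If there is no set of the first kind, a perfect matching avoiding all cuts of the second kind has
   only removable edges. *)
have [/existsP[D sD]|] := boolP [exists D, sep11 F D]; last first.
  rewrite negb_exists => /forallP noI.
  have [mu [pmu moved avoid]] := sep11_pairing (swap_b F).
  exists (swap_b F), mu; split=> //; apply: good_card; rewrite fix0 // add0n.
  rewrite (_ : [set _ in _ | _] = set0) ?cards0 //; apply/setP => u.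
  rewrite [RHS]inE; apply/negP => Bu.
  have [D [sepD]] := bad (swap_b F) mu u erefl pmu Bu.
  by rewrite (negPf (noI D)) /= => /avoid sD; rewrite sD eqxx in sepD.
have [mu [pmu moved avoid]] := sep11_pairing F.
exists F, mu; split=> //; apply: good_card; rewrite fix0 // add0n.
have [->|/set0Pn[u0 Bu0]] := eqVneq [set u in side F |
  (mu u != u) && ~~ removable [set u; mu u]] set0; first by rewrite cards0.
have crossing u : u \in [set u in side F |
      (mu u != u) && ~~ removable [set u; mu u]] ->
    exists D, (u \in D) != (mu u \in D) /\ sep11 (swap_b F) D.
  move=> Bu; have [E [sepE /orP[sE|sE]]] := bad F mu u erefl pmu Bu; last by exists E.
  by rewrite (avoid _ _ sE) eqxx in sepE.
(* By [sep11_unique] every bad edge lies in the cut of this one [X], which the matching crosses at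
   most twice. *)
have [X [_ sX]] := crossing u0 Bu0.
have [i1 o1 _] := sep11_count sX.
apply: (@leq_trans 2) => //.
have pmu' : pairing (swap_b F) mu by case: pmu.
apply: leq_trans (@crossing_le2 _ (swap_b F) X mu pmu' _ _);
  rewrite ?i1 ?o1 //.
apply/subset_leq_card/subsetP => u Bu; have [E [sepE sE]] := crossing u Bu.
rewrite -(sep11_unique sD sX sE) in sepE; rewrite inE sepE andbT.
by move: Bu; rewrite inE => /andP[].
Qed.

End Bounds.

(** * The frame of a near-bipartite cubic graph, and the bound *)

Lemma edge_connected_cut (G : sgraph) k (X : {set G}) x y :
  k_edge_connected k G -> x \in X -> y \notin X -> k <= cut X.
Proof.
case/andP=> _ /forallP conn Xx Xy; rewrite leqNgt; apply/negP => lt.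
pose E := [set p : G * G | [&& p.1 \in X, p.2 \in ~: X & adj p.1 p.2]].
pose F := [set [set p.1; p.2] | p in E].
have sF : F \subset edges G.
  apply/subsetP => e /imsetP[p]; rewrite inE => /and3P[_ _ pp] ->.
  by apply/edgesP; exists p.1, p.2.
have := conn F; rewrite sF (leq_ltn_trans (leq_imset_card _ _) lt) /=.
move/forallP/(_ x)/forallP/(_ y)/connectP => [s].
elim: s x Xx => [|z s IHs] x Xx /=; first by move=> _ eyx; rewrite eyx Xx in Xy.
case/andP=> /andP[xz nF] ps; apply: IHs => //.
apply: contraR nF => Xz; apply/imsetP; exists (x, z) => //.
by rewrite inE Xx inE Xz.
Qed.

Lemma inner_edges_le (G : sgraph) (B : {set G}) x1 x2 y1 y2 :
  (forall x y, x \in B -> y \in B -> adj x y ->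
     [set x; y] = [set x1; x2] \/ [set x; y] = [set y1; y2]) ->
  ec B B <= 2 * (([set x1; x2] \subset B) + ([set y1; y2] \subset B)).
Proof.
move=> inner.
pose two (p : G * G) := if [set p.1; p.2] \subset B then [set p; (p.2, p.1)] else set0.
have card2 p : #|two p| <= 2 * ([set p.1; p.2] \subset B).
  by rewrite /two; case: ifP; rewrite ?cards0 // cards2; case: eqP.
rewrite mulnDr; apply: leq_trans (leq_add (card2 (x1, x2)) (card2 (y1, y2))).
apply: leq_trans (leq_card_setU _ _); apply/subset_leq_card/subsetP => -[x y].
rewrite inE /= => /and3P[Bx By xy].
have sB : [set x; y] \subset B by apply/subsetP => z /set2P[]->.
have in_two p : [set x; y] = [set p.1; p.2] -> (x, y) \in two p.
  move=> exy; rewrite /two -exy sB; case: p exy => p q /= /set2_inj[] [-> ->];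
    by rewrite !inE eqxx ?orbT.
by case: (inner x y Bx By xy) => e; apply/setUP; [left|right]; apply: in_two.
Qed.

Lemma frame_of_colouring (G : sgraph) (A : {set G}) x1 x2 y1 y2 :
  k_edge_connected 3 G -> cubic G -> adj x1 x2 -> adj y1 y2 ->
  x1 \in A -> x2 \in A -> y1 \notin A -> y2 \notin A -> #|A| = #|~: A| ->
  (forall x y, adj x y -> (x \in A) = (y \in A) ->
     [set x; y] = [set x1; x2] \/ [set x; y] = [set y1; y2]) ->
  inhabited (frame G).
Proof.
move=> conn cub ax ay Ax1 Ax2 Ay1 Ay2 cardA inner; constructor.
refine (@Frame G A x1 x2 y1 y2 cub _ Ax1 Ax2 _ _ ax ay _ _ cardA); rewrite ?inE //.
- by move=> X x y; apply: edge_connected_cut.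
- move=> x y Ax Ay xy; have := inner x y xy; rewrite Ax Ay => /(_ erefl)[] /set2_inj.
    by case=> -[-> ->]; rewrite !inE eqxx ?orbT.
  by case=> -[ex ey]; rewrite ?ex ?ey (negPf Ay1) ?(negPf Ay2) in Ax Ay.
move=> x y; rewrite !inE => Ax Ay xy; have := inner x y xy.
rewrite (negPf Ax) (negPf Ay) => /(_ erefl)[] /set2_inj; last first.
  by case=> -[-> ->]; rewrite eqxx ?orbT.
by case=> -[ex ey]; rewrite ?ex ?ey ?Ax1 ?Ax2 in Ax Ay.
Qed.

(* By cubicity the numbers of edges inside the two colour classes of
   G - {e, f} agree mod 3, so e and f lie inside different classes. *)
Lemma frame_of_near_bipartite (G : sgraph) :
  k_edge_connected 3 G -> near_bipartite G -> cubic G -> inhabited (frame G).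
Proof.
move=> conn [_ nbip [e [f [Ee Ef ef bip _]]]] cub.
have [A colour] : exists A : {set G}, forall x y : G, adj x y ->
    [set x; y] \notin [set e; f] -> (x \in A) != (y \in A).
  case/existsP: bip => A /forallP colour; exists A => x y xy nF.
  have /forallP/(_ y)/implyP := colour x; apply.
  by rewrite /= /del_adj xy nF.
have flip x y : adj x y -> (x \in A) = (y \in A) ->
    [set x; y] = e \/ [set x; y] = f.
  move=> xy same; apply/set2P/negPn/negP => /(colour x y xy).
  by rewrite same eqxx.
case/edgesP: Ee => x1 [x2 [ax ex]]; case/edgesP: Ef => y1 [y2 [ay ey]].
rewrite {}ex {}ey in ef flip.
have cA := ec_degree A cub; have cB := ec_degree (~: A) cub.
rewrite (ec_splitr A) setTI setTD in cA.
rewrite (ec_splitr A) setTI setTD ecC in cB.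
have leA : ec A A <= 2 * (([set x1; x2] \subset A) + ([set y1; y2] \subset A)).
  by apply: inner_edges_le => x y Ax Ay xy; apply: flip => //; rewrite Ax Ay.
have leB : ec (~: A) (~: A)
    <= 2 * (([set x1; x2] \subset ~: A) + ([set y1; y2] \subset ~: A)).
  apply: inner_edges_le => x y; rewrite !inE => Ax Ay xy; apply: flip => //.
  by rewrite (negPf Ax) (negPf Ay).
have sub2 (x y : G) (B : {set G}) : ([set x; y] \subset B) = (x \in B) && (y \in B).
  by rewrite subUset !sub1set.
have evA := ec_even A; have evB := ec_even (~: A).
rewrite !sub2 !inE in leA leB.
have zero : 0 < ec A A + ec (~: A) (~: A).
  rewrite lt0n; apply: contra nbip; rewrite addn_eq0 => /andP[/eqP a0 /eqP b0].
  apply/existsP; exists A; apply/forallP => x; apply/forallP => y.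
  apply/implyP => xy; apply/eqP => same.
  case Ax: (x \in A) same => Ay.
    by have := ec_gt0 Ax (esym Ay) xy; rewrite a0.
  have Bx : x \in ~: A by rewrite inE Ax.
  have By : y \in ~: A by rewrite inE -Ay.
  by have := ec_gt0 Bx By xy; rewrite b0.
(* Both inner counts are even, their sum lies between 1 and 4, and they agree modulo 3; so both are
   2. *)
have [eqA half] : #|A| = #|~: A| /\
    [|| [&& x1 \in A, x2 \in A, y1 \notin A & y2 \notin A] |
        [&& y1 \in A, y2 \in A, x1 \notin A & x2 \notin A]].
  move: cA cB leA leB evA evB zero.
  move: (ec _ _) (ec _ _) (ec _ _) #|_| #|_|; clear=> i j k m n.
  move: (_ \in A) (_ \in A) (_ \in A) (_ \in A).
  by do 4!case; rewrite /=; clear=> *; split=> //; lia.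
case/orP: half => /and4P[h1 h2 h3 h4].
  exact: (@frame_of_colouring G A x1 x2 y1 y2).
apply: (@frame_of_colouring G A y1 y2 x1 x2) => // x y xy same.
by case: (flip x y xy same); [right|left].
Qed.

Theorem theorem1p3 (G : sgraph) :
  k_edge_connected 3 G -> near_bipartite G -> cubic G ->
  ~ isomorphic G (complete_graph 4) ->
  exists M : {set {set G}},
    [/\ matching M,
        (#|G|%:R / 2 - 3 <= #|M|%:R :> rat)%R &
        forall e : {set G}, e \in M -> removable e].
Proof.
move=> conn nb cub _; have [F] := frame_of_near_bipartite conn nb cub.
have [F' [mu [_ pmu le]]] : exists F' mu,
    [/\ side F' = side F, pairing F' mu & #|side F'| <= #|good F' mu| + 3].
  have [/existsP[X EX]|] := boolP [exists X, Ecut F X].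
    exact: Ecut_bound conn EX.
  by rewrite negb_exists => /forallP; exact: noEcut_bound.
have [M [mM cM rM]] := good_matching pmu; exists M; split=> //.
have cG : #|G| = #|side F'| * 2.
  by rewrite -(cardsC (side F')) -card_side muln2 addnn.
rewrite cG cM GRing.natrM GRing.mulfK //.
by rewrite Num.Theory.lerBlDr -GRing.natrD Num.Theory.ler_nat.
Qed.
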